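(* Let $n\ge 1$ be an integer, let $t>0$, let $x,x'\in\mathbb{R}^n$, and let $H_n^{E}(t,x,x')=(4\pi t)^{-n/2}\exp\left(-|x-x'|^2/4t\right)$ be the Euclidean heat kernel. Then for every real $\sigma>0$, $$H_n^{E}(t,x,x')=\frac{\Gamma((n+1)/2)}{2i\,\pi^{n/2+1}(4t)^{1/2}}\int_{\sigma-i\infty}^{\sigma+i\infty}\frac{e^{s/4t}}{(|x-x'|^2+s)^{(n+1)/2}}\,ds,$$ and for every real $a>0$, $$H_n^{E}(t,x,x')=\frac{\Gamma((n+1)/2)}{\pi^{n/2+1}(4t)^{1/2}}\int_0^\infty \mathrm{Re}\left[\frac{e^{(a-i\xi)/4t}}{(|x-x'|^2+a-i\xi)^{(n+1)/2}}\right]d\xi.$$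
   Context: Powers of complex numbers with positive real part are taken with the principal branch. The integral $\int_{\sigma-i\infty}^{\sigma+i\infty}$ is along the vertical line $\mathrm{Re}\,s=\sigma$, oriented upward, and both integrals are understood as improper integrals, i.e. $\lim_{R\to\infty}\int_{\sigma-iR}^{\sigma+iR}$ and $\lim_{R\to\infty}\int_0^R$ respectively. $H_n^{E}$ is the integral kernel of the heat semigroup $e^{t\Delta}$ on $\mathbb{R}^n$. *)

(* Defs.v *)
(* Built on Stdlib's real numbers and Coquelicot. *)
From Stdlib Require Import Reals Vector.
From Coquelicot Require Import Coquelicot.

Local Open Scope R_scope.

Definition dist_eucl {n : nat} (x y : Vector.t R n) : R :=
  sqrt (Vector.fold_right Rplus (Vector.map2 (fun a b => (a - b) ^ 2) x y) 0).

Definition heat_kernel (n : nat) (t : R) (x y : Vector.t R n) : R :=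
  Rpower (4 * PI * t) (- (INR n / 2)) * exp (- (dist_eucl x y) ^ 2 / (4 * t)).

(* Euler's integral; it converges exactly for z > 0, and RInt_gen is
   unspecified where it does not. *)
Definition Gamma (z : R) : R :=
  RInt_gen (fun u : R => Rpower u (z - 1) * exp (- u))
    (at_right 0) (Rbar_locally p_infty).

Definition Cexp (z : C) : C :=
  (exp (Re z) * cos (Im z), exp (Re z) * sin (Im z)).

(* Principal argument, with values in (-PI, PI]; by convention Carg 0 = 0. *)
Definition Carg (z : C) : R :=
  if Rlt_dec 0 (Re z) then atan (Im z / Re z)
  else if Rlt_dec (Re z) 0 then
    if Rle_dec 0 (Im z) then atan (Im z / Re z) + PI
    else atan (Im z / Re z) - PI
  else if Rlt_dec 0 (Im z) then PI / 2
  else if Rlt_dec (Im z) 0 then - (PI / 2)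
  else 0.

Definition Clog (z : C) : C := (ln (Cmod z), Carg z).

(* Principal branch of z to a real power, for z <> 0. *)
Definition Cpower (z : C) (p : R) : C := Cexp (RtoC p * Clog z)%C.

(* The integral of f along the upward segment from sigma - iT to sigma + iT,
   parametrized by s = sigma + i xi, so that ds = i dxi. *)
Definition is_vertical_segment_RInt (f : C -> C) (sigma T : R) (l : C) : Prop :=
  @is_RInt C_R_NormedModule
    (fun xi : R => (Ci * f (RtoC sigma + Ci * RtoC xi))%C) (- T) T l.

(* The same shape as is_RInt_gen, whose product filter would instead let the
   two ends of the line go to infinity independently of each other. *)
Definition is_vertical_line_RInt (f : C -> C) (sigma : R) (l : C) : Prop :=
  filterlimi (is_vertical_segment_RInt f sigma) (Rbar_locally p_infty)
    (@locally C_UniformSpace l).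

(* Main.v *)
(* With p = (n + 1) / 2, lambda = 1 / (4 t) and c = lambda (|x - x'|^2 + sigma),
   scaling reduces both formulas to
     Gamma(p) lim_T int_0^T Re (e^(c + i xi) / (c + i xi)^p) dxi = PI.
   Integration by parts gives the passage from p to p + 1 on both factors, so
   only p = 1/2 and p = 1 remain.  For p = 1/2 the substitution s = w^2 turns
   the line into a hyperbola, which is deformed onto the imaginary axis, where
   e^(w^2) is a Gaussian.  For p = 1 the limit of the integral of e^s / s does
   not depend on c, and that of e^(-s) / s vanishes since c can be sent to
   infinity; adding the two leaves the Poisson kernel c / (c^2 + xi^2) against
   cos xi, which tends to PI / 2 as c tends to 0. *)
Require Import Defs.
From Stdlib Require Import Reals Vector Lra Lia.
From Coquelicot Require Import Coquelicot.

Local Open Scope R_scope.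

(** * Calculus preliminaries *)

(** At p = 1/2 and p = 1 the integrals converge only conditionally: |s|^(-p) is not integrable along
    the line, so limits cannot simply be taken under the integral sign. Everything is therefore done
    on truncated integrals with explicit error bounds. Contours are moved by real calculus: a
    truncated integral is differentiated in a real parameter, and the Cauchy-Riemann equations turn
    the differentiated integrand into an exact derivative, so that only boundary terms remain. Where
    an abscissa and a height both have to move, the abscissa is made a function of T (sqrt T on the
    way to the far right, 1/T on the way to the imaginary axis), which leaves a single limit. The
    exponent 1/2 lies below the range p >= 1 given by n >= 1. It serves as a seed because ds / sqrt
    s = 2 dw removes the branch point altogether; for p = 1 the pole at 0 remains, hence the
    separate argument through the Poisson kernel. *)

Lemma continuous_of_derive (f : R -> R) (x : R) : ex_derive f x -> continuous f x.
Proof. apply (ex_derive_continuous (V := R_NormedModule)). Qed.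

Lemma ex_RInt_of_derive (f : R -> R) (a b : R) :
  (forall x, Rmin a b <= x <= Rmax a b -> ex_derive f x) -> ex_RInt f a b.
Proof.
  intros H; apply (ex_RInt_continuous (V := R_CompleteNormedModule)).
  intros x Hx; apply continuous_of_derive; auto.
Qed.

Lemma is_derive_eq (f : R -> R) (x l l' : R) :
  l' = l -> is_derive f x l -> is_derive f x l'.
Proof. intros ->; auto. Qed.

Lemma is_derive_RInt_upper (f : R -> R) (x : R) :
  (forall y, continuous f y) -> is_derive (fun z => RInt f 0 z) x (f x).
Proof.
  intros Hf; apply (is_derive_RInt f _ 0 x); [|apply Hf].
  apply filter_forall; intros y.
  apply (RInt_correct (V := R_CompleteNormedModule)).
  now apply (ex_RInt_continuous (V := R_CompleteNormedModule)).
Qed.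

Lemma RInt_of_derive (f df : R -> R) (a b : R) :
  (forall x, Rmin a b <= x <= Rmax a b -> is_derive f x (df x)) ->
  (forall x, Rmin a b <= x <= Rmax a b -> continuous df x) ->
  RInt df a b = f b - f a.
Proof.
  intros H1 H2; apply (is_RInt_unique (V := R_CompleteNormedModule)).
  now apply (is_RInt_derive (V := R_CompleteNormedModule)).
Qed.

Lemma continuity_2d_Derive (f df : R -> R -> R) (x t : R) :
  locally x (fun y => forall s, is_derive (fun z => f z s) y (df y s)) ->
  continuity_2d_pt df x t ->
  continuity_2d_pt (fun u v => Derive (fun z => f z v) u) x t.
Proof.
  intros [e He] Hc; apply continuity_2d_pt_ext_loc with (2 := Hc).
  exists e; intros u v Hu _; symmetry; apply is_derive_unique, He, Hu.
Qed.

(** Regularity is asked only near x, because the integrands with a pole at 0 are later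
    differentiated in an abscissa restricted to c > 0. *)
Lemma is_derive_RInt_parameter (f df : R -> R -> R) (a b x : R) :
  locally x (fun y => forall s, is_derive (fun z => f z s) y (df y s)) ->
  (forall t, continuity_2d_pt df x t) ->
  locally x (fun y => ex_RInt (f y) a b) ->
  is_derive (fun z => RInt (f z) a b) x (RInt (df x) a b).
Proof.
  intros H1 H2 H3.
  apply (is_derive_eq _ _ (RInt (fun t => Derive (fun u => f u t) x) a b)).
  - apply RInt_ext; intros s _; symmetry.
    apply is_derive_unique, (locally_singleton _ _ H1).
  - apply (is_derive_RInt_param f a b x).
    + revert H1; apply filter_imp; intros y Hy t _; eexists; apply Hy.
    + intros t _; now apply continuity_2d_Derive with df.
    + exact H3.
Qed.

Lemma is_derive_RInt_parameter_upper (f df : R -> R -> R) (b : R -> R) (x db : R) :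
  (forall y s, is_derive (fun z => f z s) y (df y s)) ->
  (forall y t, continuity_2d_pt df y t) ->
  (forall y t, continuous (f y) t) ->
  is_derive b x db ->
  is_derive (fun z => RInt (f z) 0 (b z)) x (RInt (df x) 0 (b x) + f x (b x) * db).
Proof.
  intros H1 H2 H3 Hb.
  assert (Hex : forall y c d, ex_RInt (f y) c d).
  { intros y c d; apply (ex_RInt_continuous (V := R_CompleteNormedModule)); auto. }
  apply (is_derive_eq _ _
    (RInt (fun t => Derive (fun u => f u t) x) 0 (b x) + - f x 0 * 0 + f x (b x) * db)).
  - rewrite Rmult_0_r, Rplus_0_r; f_equal.
    apply RInt_ext; intros s _; symmetry; apply is_derive_unique, H1.
  - assert (HD : forall u v, continuity_2d_pt (fun u v => Derive (fun z => f z v) u) u v).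
    { intros u v; apply continuity_2d_Derive with df; auto.
      apply filter_forall; auto. }
    apply (is_derive_RInt_param_bound_comp f (fun _ => 0) b x 0 db); auto.
    1: apply filter_forall; auto.
    1,2: exists posreal_one; apply filter_forall; auto.
    1: apply (is_derive_const (V := R_NormedModule)).
    1: exists posreal_one; apply filter_forall; intros y t _; eexists; apply H1.
    1,2: exists posreal_one; auto.
    1,2: apply continuity_pt_filterlim, H3.
Qed.

Ltac cont2d :=
  repeat match goal with
  (* This case catches the product of the two variables in eta-reduced form. *)
  | |- continuity_2d_pt Rmult _ _ => apply (continuity_2d_pt_mult (fun u v => u) (fun u v => v))
  | |- continuity_2d_pt (fun u v => u) _ _ => apply continuity_2d_pt_id1
  | |- continuity_2d_pt (fun u v => v) _ _ => apply continuity_2d_pt_id2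
  | |- continuity_2d_pt (fun u v => ?c) _ _ => apply continuity_2d_pt_const
  | |- continuity_2d_pt (fun u v => _ * _) _ _ => apply continuity_2d_pt_mult
  | |- continuity_2d_pt (fun u v => _ + _) _ _ => apply continuity_2d_pt_plus
  | |- continuity_2d_pt (fun u v => _ - _) _ _ => apply continuity_2d_pt_minus
  | |- continuity_2d_pt (fun u v => - _) _ _ => apply continuity_2d_pt_opp
  | |- continuity_2d_pt (fun u v => / _) _ _ => apply continuity_2d_pt_inv
  | |- continuity_2d_pt (fun u v => exp _) _ _ =>
      apply (continuity_1d_2d_pt_comp exp); [apply derivable_continuous_pt, derivable_pt_exp|]
  | |- continuity_2d_pt (fun u v => cos _) _ _ =>
      apply (continuity_1d_2d_pt_comp cos); [apply derivable_continuous_pt, derivable_pt_cos|]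
  | |- continuity_2d_pt (fun u v => sin _) _ _ =>
      apply (continuity_1d_2d_pt_comp sin); [apply derivable_continuous_pt, derivable_pt_sin|]
  end.

Lemma one_plus_sqr_pos (s : R) : 0 < 1 + s ^ 2.
Proof. generalize (pow2_ge_0 s); lra. Qed.

Lemma const_of_derive_zero (f : R -> R) (a b : R) :
  (forall x, is_derive f x 0) -> f a = f b.
Proof.
  intros H.
  generalize (RInt_of_derive f (fun _ => 0) a b (fun x _ => H x) (fun x _ => continuous_const 0 x)).
  rewrite RInt_const; unfold scal; simpl; unfold mult; simpl; lra.
Qed.

Lemma is_lim_of_bound (f g : R -> R) (l : R) :
  (forall x, 1 < x -> Rabs (f x - l) <= g x) ->
  is_lim g p_infty 0 -> is_lim f p_infty l.
Proof.
  intros H Hg.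
  apply (is_lim_le_le_loc (fun x => l - g x) (fun x => l + g x)).
  - exists 1; intros x Hx; generalize (H x Hx); intros Ha.
    apply Rabs_le_between in Ha; lra.
  - replace (Finite l) with (Rbar_minus l 0) by (simpl; f_equal; ring).
    apply is_lim_minus'; [apply is_lim_const|exact Hg].
  - replace (Finite l) with (Rbar_plus l 0) by (simpl; f_equal; ring).
    apply is_lim_plus'; [apply is_lim_const|exact Hg].
Qed.

Lemma is_lim_scal_inv (k : R) : is_lim (fun x => k / x) p_infty 0.
Proof.
  replace (Finite 0) with (Rbar_mult k (Rbar_inv p_infty)) by (simpl; f_equal; ring).
  apply (is_lim_scal_l (fun x => / x)).
  apply is_lim_inv; [apply is_lim_id|discriminate].
Qed.

Lemma exp_le_compat (x y : R) : x <= y -> exp x <= exp y.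
Proof. intros [H | ->]; [left; now apply exp_increasing|right; auto]. Qed.

Lemma exp_neg_le_inv (x : R) : 0 < x -> exp (- x) <= / x.
Proof.
  intros Hx; rewrite exp_Ropp; apply Rinv_le_contravar; auto.
  generalize (exp_ineq1 x); lra.
Qed.

(** * The Gaussian integral *)

Definition gauss (x : R) : R := RInt (fun v => exp (- v ^ 2)) 0 x.

Lemma ex_RInt_gauss (a b : R) : ex_RInt (fun v => exp (- v ^ 2)) a b.
Proof. apply ex_RInt_of_derive; intros; auto_derive; auto. Qed.

Lemma is_derive_gauss (x : R) : is_derive gauss x (exp (- x ^ 2)).
Proof.
  apply (is_derive_RInt_upper (fun v => exp (- v ^ 2))).
  intros y; apply continuous_of_derive; auto_derive; auto.
Qed.

Lemma gauss_scaling (x : R) :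
  RInt (fun s => x * exp (- (x * s) ^ 2)) 0 1 = gauss x.
Proof.
  rewrite (RInt_of_derive (fun s => gauss (x * s))).
  - rewrite Rmult_1_r, Rmult_0_r; unfold gauss at 2.
    rewrite RInt_point; unfold zero; simpl; ring.
  - intros s _.
    apply (is_derive_comp (V := R_NormedModule) gauss (fun s => x * s) s
             (exp (- (x * s) ^ 2)) x); [apply is_derive_gauss|].
    auto_derive; auto; ring.
  - intros s _; apply continuous_of_derive; auto_derive; auto.
Qed.

(** The companion of [gauss] in the classical parameter proof: its derivative is the opposite of
    that of [gauss x ^ 2], it starts at atan 1 and it decays to 0, so the square of the Gaussian
    integral can be read off. *)
Definition gauss_aux (x : R) : R :=
  RInt (fun s => exp (- x ^ 2 * (1 + s ^ 2)) / (1 + s ^ 2)) 0 1.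

Lemma ex_RInt_gauss_aux (x : R) :
  ex_RInt (fun s => exp (- x ^ 2 * (1 + s ^ 2)) / (1 + s ^ 2)) 0 1.
Proof.
  apply ex_RInt_of_derive; intros s _; auto_derive.
  generalize (one_plus_sqr_pos s); lra.
Qed.

Lemma is_derive_gauss_aux (x : R) :
  is_derive gauss_aux x (- 2 * exp (- x ^ 2) * gauss x).
Proof.
  apply (is_derive_eq _ _ (RInt (fun s => - 2 * exp (- x ^ 2) * (x * exp (- (x * s) ^ 2))) 0 1)).
  - rewrite <- gauss_scaling; symmetry.
    apply (RInt_scal (V := R_CompleteNormedModule) (fun s => x * exp (- (x * s) ^ 2))).
    apply ex_RInt_of_derive; intros; auto_derive; auto.
  - apply (is_derive_RInt_parameter (fun z s => exp (- z ^ 2 * (1 + s ^ 2)) / (1 + s ^ 2))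
      (fun y s => - 2 * exp (- y ^ 2) * (y * exp (- (y * s) ^ 2)))).
    + apply filter_forall; intros y s.
      auto_derive; generalize (one_plus_sqr_pos s); intros Hs; [lra|].
      replace (- 2 * exp (- y ^ 2) * (y * exp (- (y * s) ^ 2))) with
        (- 2 * y * (exp (- y ^ 2) * exp (- (y * s) ^ 2))) by ring.
      rewrite <- exp_plus.
      replace (- y ^ 2 + - (y * s) ^ 2) with (- (y * (y * 1)) * (1 + s * (s * 1))) by ring.
      field; lra.
    + intros t; simpl; cont2d.
    + apply filter_forall; intros y; apply ex_RInt_gauss_aux.
Qed.

Lemma gauss_aux_0 : gauss_aux 0 = PI / 4.
Proof.
  unfold gauss_aux.
  rewrite (RInt_ext _ (fun s => / (1 + s ^ 2))).
  - rewrite (RInt_of_derive atan).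
    + rewrite atan_1, atan_0; ring.
    + intros s _; rewrite <- Rsqr_pow2; apply is_derive_atan.
    + intros s _; apply continuous_of_derive; auto_derive.
      generalize (one_plus_sqr_pos s); lra.
  - intros s _; replace (- 0 ^ 2 * (1 + s ^ 2)) with 0 by ring.
    rewrite exp_0; unfold Rdiv; apply Rmult_1_l.
Qed.

Lemma gauss_sqr (x : R) : gauss x ^ 2 + gauss_aux x = PI / 4.
Proof.
  rewrite (const_of_derive_zero (fun z => gauss z ^ 2 + gauss_aux z) x 0).
  - rewrite gauss_aux_0; unfold gauss; rewrite RInt_point; unfold zero; simpl; ring.
  - intros z; apply (is_derive_eq _ _ (2 * exp (- z ^ 2) * gauss z + (- 2 * exp (- z ^ 2) * gauss z))); [ring|].
    apply (is_derive_plus (V := R_NormedModule)); [|apply is_derive_gauss_aux].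
    apply (is_derive_eq _ _ (INR 2 * exp (- z ^ 2) * gauss z ^ 1)); [simpl; ring|].
    apply is_derive_pow, is_derive_gauss.
Qed.

Lemma gauss_nonneg (x : R) : 0 <= x -> 0 <= gauss x.
Proof.
  intros Hx; apply RInt_ge_0; auto; [apply ex_RInt_gauss|].
  intros; apply Rlt_le, exp_pos.
Qed.

Lemma gauss_aux_bound (x : R) : 1 < x -> Rabs (gauss_aux x) <= 1 / x.
Proof.
  intros Hx; rewrite <- (Rmult_1_l (1 / x)), <- (Rminus_0_r 1) at 1.
  apply abs_RInt_le_const; [lra|apply ex_RInt_gauss_aux|].
  intros s _; generalize (one_plus_sqr_pos s) (pow2_ge_0 s); intros H1 H2.
  rewrite Rabs_pos_eq.
  2: apply Rlt_le, Rdiv_lt_0_compat; [apply exp_pos|lra].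
  apply Rle_trans with (exp (- x ^ 2 * (1 + s ^ 2))).
  - apply Rle_div_l; [lra|].
    rewrite <- (Rmult_1_r (exp _)) at 1.
    apply Rmult_le_compat_l; [apply Rlt_le, exp_pos|lra].
  - apply Rle_trans with (exp (- x)).
    + apply exp_le_compat; nra.
    + unfold Rdiv; rewrite Rmult_1_l; apply exp_neg_le_inv; lra.
Qed.

Lemma is_lim_gauss : is_lim gauss p_infty (sqrt PI / 2).
Proof.
  assert (HP := PI_RGT_0).
  replace (sqrt PI / 2) with (sqrt (PI / 4)).
  2:{ rewrite sqrt_div by lra; f_equal.
      replace 4 with (2 * 2) by ring; apply sqrt_square; lra. }
  apply (is_lim_ext_loc (fun x => sqrt (gauss x ^ 2))).
  { exists 0; intros x Hx; apply sqrt_pow2, gauss_nonneg; lra. }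
  apply (is_lim_comp_continuous (fun x => gauss x ^ 2) sqrt).
  - apply (is_lim_of_bound _ (fun x => 1 / x)); [|apply is_lim_scal_inv].
    intros x Hx; generalize (gauss_sqr x); intros He.
    replace (gauss x ^ 2 - PI / 4) with (- gauss_aux x) by lra.
    rewrite Rabs_Ropp; now apply gauss_aux_bound.
  - apply continuity_pt_filterlim, continuity_pt_sqrt; lra.
Qed.

(** * The Gamma function at half-integers *)

(** Only the primitive needs a limit at 0; the integrand may be singular or irregular there, as
    u^(p-1) is. *)
Lemma is_RInt_gen_of_derive (f F : R -> R) (la lb : R) :
  (forall u, 0 < u -> is_derive F u (f u)) ->
  (forall u, 0 < u -> continuous f u) ->
  filterlim F (at_right 0) (locally la) ->
  is_lim F p_infty lb ->
  is_RInt_gen f (at_right 0) (Rbar_locally p_infty) (lb - la).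
Proof.
  intros HF Hf Ha Hb.
  apply (filterlimi_lim_ext_loc (fun ab : R * R => minus (F (snd ab)) (F (fst ab)))).
  - apply (Filter_prod _ _ _ (fun u => 0 < u) (fun u => 0 < u)).
    + exists posreal_one; auto.
    + exists 0; auto.
    + intros a b Ha' Hb'; apply (is_RInt_derive (V := R_CompleteNormedModule)).
      * intros u [Hu _]; apply HF; revert Hu; unfold Rmin; destruct Rle_dec; simpl in *; lra.
      * intros u [Hu _]; apply Hf; revert Hu; unfold Rmin; destruct Rle_dec; simpl in *; lra.
  - unfold minus; apply (filterlim_comp_2 (G := locally lb) (H := locally (opp la))
      (fun ab : R * R => F (snd ab)) (fun ab : R * R => opp (F (fst ab))) plus).
    + eapply filterlim_comp; [apply filterlim_snd|exact Hb].
    + eapply filterlim_comp; [|apply (filterlim_opp (V := R_NormedModule) la)].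
      eapply filterlim_comp; [apply filterlim_fst|exact Ha].
    + apply (filterlim_plus (V := R_NormedModule)).
Qed.

Lemma filterlim_at_right_0 (f : R -> R) :
  f 0 = 0 -> continuous f 0 -> filterlim f (at_right 0) (locally 0).
Proof.
  intros H0 H; unfold continuous in H; rewrite H0 in H.
  apply (filterlim_filter_le_1 (F := locally 0) (G := at_right 0) f) with (2 := H).
  apply filter_le_within.
Qed.

Definition Gamma_integrand (p u : R) : R := Rpower u (p - 1) * exp (- u).

Definition is_Gamma (p g : R) : Prop :=
  is_RInt_gen (Gamma_integrand p) (at_right 0) (Rbar_locally p_infty) g.

Lemma Gamma_unique (p g : R) : is_Gamma p g -> Gamma p = g.
Proof. exact (is_RInt_gen_unique (V := R_CompleteNormedModule) (Gamma_integrand p) g). Qed.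

Lemma is_lim_exp_opp : is_lim (fun u => exp (- u)) p_infty 0.
Proof.
  apply (is_lim_of_bound _ (fun x => 1 / x)); [|apply is_lim_scal_inv].
  intros x Hx; rewrite Rminus_0_r, Rabs_pos_eq by (apply Rlt_le, exp_pos).
  unfold Rdiv; rewrite Rmult_1_l; apply exp_neg_le_inv; lra.
Qed.

Lemma is_Gamma_1 : is_Gamma 1 1.
Proof.
  unfold is_Gamma; apply (is_RInt_gen_ext (fun u => exp (- u))).
  - apply filter_forall; intros ab u _; unfold Gamma_integrand.
    rewrite Rminus_diag; unfold Rpower; rewrite Rmult_0_l, exp_0.
    symmetry; apply Rmult_1_l.
  - replace 1 with (0 - - 1) by ring.
    apply (is_RInt_gen_of_derive _ (fun u => - exp (- u))).
    + intros u _; auto_derive; auto; ring.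
    + intros u _; apply continuous_of_derive; auto_derive; auto.
    + apply (filterlim_filter_le_1 (F := locally 0) (G := at_right 0)); [apply filter_le_within|].
      replace (- 1) with (- exp (- 0)) by (rewrite Ropp_0, exp_0; ring).
      apply (continuous_of_derive (fun u => - exp (- u))); auto_derive; auto.
    + replace (Finite 0) with (Rbar_opp 0) by (simpl; f_equal; ring).
      apply is_lim_opp, is_lim_exp_opp.
Qed.

(** From ln u <= 2 (sqrt u - 1) the exponent (p + 1) ln u - u is at most a concave quadratic in sqrt
    u, and completing the square bounds it; the constant 2 (p + 1)^2 is generous. *)
Lemma Rpower_mul_exp_opp_le (p u : R) : 0 <= p -> 1 < u ->
  Rpower u p * exp (- u) <= exp (2 * (p + 1) ^ 2) / u.
Proof.
  intros Hp Hu.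
  assert (Hl : ln u <= 2 * (sqrt u - 1)).
  { rewrite <- (sqrt_sqrt u) at 1 by lra.
    assert (Hs := sqrt_lt_R0 u ltac:(lra)).
    rewrite ln_mult by auto.
    generalize (exp_ineq1_le (ln (sqrt u))); rewrite exp_ln by auto; lra. }
  unfold Rpower; apply (Rle_div_r _ _ u); [lra|].
  rewrite <- (exp_ln u) at 3 by lra.
  rewrite <- !exp_plus; apply exp_le_compat.
  assert (Hq : sqrt u ^ 2 = u) by (apply pow2_sqrt; lra).
  generalize (pow2_ge_0 (sqrt u - (p + 1))); nra.
Qed.

Lemma is_lim_Rpower_mul_exp_opp (p : R) : 0 <= p ->
  is_lim (fun u => Rpower u p * exp (- u)) p_infty 0.
Proof.
  intros Hp; apply (is_lim_of_bound _ (fun x => exp (2 * (p + 1) ^ 2) / x)); [|apply is_lim_scal_inv].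
  intros x Hx; rewrite Rminus_0_r, Rabs_pos_eq; [now apply Rpower_mul_exp_opp_le|].
  apply Rmult_le_pos; apply Rlt_le, exp_pos.
Qed.

Lemma filterlim_Rpower_mul_exp_opp_0 (p : R) : 0 < p ->
  filterlim (fun u => Rpower u p * exp (- u)) (at_right 0) (locally 0).
Proof.
  intros Hp P [e He].
  (* The radius is e^(1/p), so that u^p < e below it. *)
  exists (mkposreal _ (exp_pos (ln e / p))); intros u Hu Hu0; apply He.
  unfold ball in *; simpl in *; unfold AbsRing_ball, abs, minus, plus, opp in *; simpl in *.
  rewrite Ropp_0, Rplus_0_r in *.
  rewrite Rabs_pos_eq in * by lra.
  rewrite Rabs_pos_eq.
  2: apply Rmult_le_pos; apply Rlt_le, exp_pos.
  assert (H1 : exp (- u) <= 1) by (rewrite <- exp_0; apply exp_le_compat; lra).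
  apply Rle_lt_trans with (Rpower u p * 1).
  - apply Rmult_le_compat_l; [apply Rlt_le, exp_pos|auto].
  - rewrite Rmult_1_r; unfold Rpower.
    rewrite <- (exp_ln e) at 1 by apply cond_pos.
    apply exp_increasing.
    apply ln_increasing in Hu; auto; rewrite ln_exp in Hu.
    apply Rlt_div_r in Hu; lra.
Qed.

(** The integrand at p + 1 is p times the one at p minus the derivative of u^p e^(-u), which
    vanishes at both ends. Convergence at p + 1 thus comes together with the value. *)
Lemma is_Gamma_step (p g : R) : 0 < p -> is_Gamma p g -> is_Gamma (p + 1) (p * g).
Proof.
  intros Hp Hg.
  unfold is_Gamma; apply (is_RInt_gen_ext (fun u => minus (scal p (Gamma_integrand p u))
           (p * Gamma_integrand p u - Gamma_integrand (p + 1) u))).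
  - apply filter_forall; intros ab u _; unfold minus, scal, plus, opp; simpl; unfold mult; simpl.
    ring.
  - replace (p * g) with (minus (scal p g) (0 - 0)).
    2: unfold minus, scal, plus, opp; simpl; unfold mult; simpl; ring.
    apply (is_RInt_gen_minus (V := R_NormedModule)).
    + now apply (is_RInt_gen_scal (V := R_NormedModule)).
    + apply (is_RInt_gen_of_derive _ (fun u => Rpower u p * exp (- u))).
      * intros u Hu; unfold Gamma_integrand, Rpower; auto_derive; auto.
        replace (p + 1 - 1) with p by ring.
        replace ((p - 1) * ln u) with (p * ln u + - ln u) by ring.
        rewrite exp_plus, exp_Ropp, (exp_Ropp (ln u)), exp_ln by auto; field.
        split; [apply Rgt_not_eq, exp_pos|lra].
      * intros u Hu; unfold Gamma_integrand, Rpower; apply continuous_of_derive; auto_derive; auto.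
      * now apply filterlim_Rpower_mul_exp_opp_0.
      * apply is_lim_Rpower_mul_exp_opp; lra.
Qed.

Lemma is_Gamma_3_2 : is_Gamma (3 / 2) (sqrt PI / 2).
Proof.
  unfold is_Gamma; replace (sqrt PI / 2) with (sqrt PI / 2 - 0) by ring.
  (* This primitive of sqrt u e^(-u) comes from one integration by parts followed by u = v^2. *)
  apply (is_RInt_gen_of_derive _ (fun u => gauss (sqrt u) - Rpower u (1 / 2) * exp (- u))).
  - intros u Hu; assert (Hs := sqrt_lt_R0 u Hu).
    apply (is_derive_eq _ _ (exp (- u) * / (2 * sqrt u) -
      (exp (- u) * / (2 * sqrt u) - Gamma_integrand (3 / 2) u))); [ring|].
    apply (is_derive_minus (V := R_NormedModule)).
    + apply (is_derive_eq _ _ (scal (/ (2 * sqrt u)) (exp (- sqrt u ^ 2)))).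
      * rewrite pow2_sqrt by lra; unfold scal; simpl; unfold mult; simpl; ring.
      * apply (is_derive_comp (V := R_NormedModule) gauss sqrt u); [apply is_derive_gauss|].
        auto_derive; auto; field; lra.
    + apply (is_derive_ext_loc (fun v => sqrt v * exp (- v))).
      * exists (mkposreal u Hu); intros v Hv.
        unfold ball in Hv; simpl in Hv; unfold AbsRing_ball, abs, minus, plus, opp in Hv; simpl in Hv.
        apply Rabs_lt_between in Hv.
        replace (1 / 2) with (/ 2) by field; rewrite Rpower_sqrt by lra; reflexivity.
      * unfold Gamma_integrand; replace (3 / 2 - 1) with (/ 2) by field.
        rewrite Rpower_sqrt by lra; auto_derive; auto; field; lra.
  - intros u Hu; unfold Gamma_integrand, Rpower; apply continuous_of_derive; auto_derive; auto.
  - replace 0 with (0 + - 0) at 2 by ring.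
    apply (filterlim_comp_2 (G := locally 0) (H := locally (- 0))
      (fun u => gauss (sqrt u)) (fun u => opp (Rpower u (1 / 2) * exp (- u))) plus).
    + apply (filterlim_at_right_0 (fun u => gauss (sqrt u))).
      * rewrite sqrt_0; unfold gauss; apply (RInt_point (V := R_CompleteNormedModule)).
      * apply (continuous_comp sqrt gauss).
        -- apply continuity_pt_filterlim, continuity_pt_sqrt; lra.
        -- apply continuous_of_derive; eexists; apply is_derive_gauss.
    + eapply filterlim_comp; [apply filterlim_Rpower_mul_exp_opp_0; lra|].
      apply (filterlim_opp (V := R_NormedModule) 0).
    + apply (filterlim_plus (V := R_NormedModule) 0 (- 0)).
  - replace (Finite (sqrt PI / 2)) with (Finite (sqrt PI / 2 - 0)) by (f_equal; ring).
    apply is_lim_minus'.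
    + apply (is_lim_comp gauss sqrt p_infty (sqrt PI / 2) p_infty).
      * apply is_lim_gauss.
      * apply (is_lim_sqrt_p (fun x => x)), is_lim_id.
      * exists 0; discriminate.
    + apply is_lim_Rpower_mul_exp_opp; lra.
Qed.

(** * The kernel and the recursion in p *)

(** The modulus |c + i xi|^(-p). As an exponential it is multiplicative in p, and it still makes
    sense at c = 0, where it serves as a bound independent of c. *)
Definition kernel_mod (p c xi : R) : R := exp (- p * (ln (c ^ 2 + xi ^ 2) / 2)).

(* [kernel_re] and [kernel_im] are the real and imaginary parts of
   e^(i xi) / (c + i xi)^p, for c > 0. *)
Definition kernel_re (p c xi : R) : R :=
  kernel_mod p c xi * cos (xi - p * atan (xi / c)).

Definition kernel_im (p c xi : R) : R :=
  kernel_mod p c xi * sin (xi - p * atan (xi / c)).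

Lemma sum_sqr_pos (c xi : R) : 0 < c -> 0 < c ^ 2 + xi ^ 2.
Proof. intros Hc; generalize (pow2_ge_0 xi); nra. Qed.

Lemma kernel_mod_plus (p q c xi : R) :
  kernel_mod (p + q) c xi = kernel_mod p c xi * kernel_mod q c xi.
Proof. unfold kernel_mod; rewrite <- exp_plus; f_equal; ring. Qed.

Lemma kernel_mod_1 (c xi : R) : 0 < c -> kernel_mod 1 c xi = / sqrt (c ^ 2 + xi ^ 2).
Proof.
  intros Hc; assert (H := sum_sqr_pos c xi Hc).
  unfold kernel_mod; rewrite <- Rpower_sqrt, <- Rpower_Ropp by auto.
  unfold Rpower; f_equal; field.
Qed.

Lemma cos_atan_div (c xi : R) : 0 < c ->
  cos (atan (xi / c)) = c / sqrt (c ^ 2 + xi ^ 2).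
Proof.
  intros Hc; assert (H := sum_sqr_pos c xi Hc).
  rewrite cos_atan.
  replace (1 + (xi / c)²) with ((c ^ 2 + xi ^ 2) / c ^ 2) by (unfold Rsqr; field; lra).
  rewrite sqrt_div by nra.
  rewrite sqrt_pow2 by lra; field.
  assert (Hs := sqrt_lt_R0 _ H); split; lra.
Qed.

Lemma sin_atan_div (c xi : R) : 0 < c ->
  sin (atan (xi / c)) = xi / sqrt (c ^ 2 + xi ^ 2).
Proof.
  intros Hc; assert (H := sum_sqr_pos c xi Hc).
  rewrite sin_atan.
  replace (1 + (xi / c)²) with ((c ^ 2 + xi ^ 2) / c ^ 2) by (unfold Rsqr; field; lra).
  rewrite sqrt_div by nra.
  rewrite sqrt_pow2 by lra; field.
  assert (Hs := sqrt_lt_R0 _ H); split; lra.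
Qed.

(** Together with [polar_im] this is the polar form of 1 / (c + i xi), which trades the arctangent
    for rational functions. *)
Lemma polar_re (c xi : R) : 0 < c ->
  kernel_mod 1 c xi * cos (atan (xi / c)) = c / (c ^ 2 + xi ^ 2).
Proof.
  intros Hc; assert (H := sum_sqr_pos c xi Hc).
  rewrite kernel_mod_1, cos_atan_div by auto.
  rewrite <- (sqrt_sqrt (c ^ 2 + xi ^ 2)) at 3 by lra.
  field; apply Rgt_not_eq, sqrt_lt_R0; auto.
Qed.

Lemma polar_im (c xi : R) : 0 < c ->
  kernel_mod 1 c xi * sin (atan (xi / c)) = xi / (c ^ 2 + xi ^ 2).
Proof.
  intros Hc; assert (H := sum_sqr_pos c xi Hc).
  rewrite kernel_mod_1, sin_atan_div by auto.
  rewrite <- (sqrt_sqrt (c ^ 2 + xi ^ 2)) at 3 by lra.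
  field; apply Rgt_not_eq, sqrt_lt_R0; auto.
Qed.

Lemma kernel_re_1 (c xi : R) : 0 < c ->
  kernel_re 1 c xi = (c * cos xi + xi * sin xi) / (c ^ 2 + xi ^ 2).
Proof.
  intros Hc; unfold kernel_re; rewrite Rmult_1_l, cos_minus.
  transitivity (cos xi * (c / (c ^ 2 + xi ^ 2)) + sin xi * (xi / (c ^ 2 + xi ^ 2))).
  - rewrite <- polar_re, <- polar_im by auto; ring.
  - field; apply Rgt_not_eq, sum_sqr_pos, Hc.
Qed.

Lemma continuous_kernel_re (p c xi : R) : 0 < c -> continuous (kernel_re p c) xi.
Proof.
  intros Hc; unfold kernel_re, kernel_mod; apply continuous_of_derive; auto_derive.
  apply (sum_sqr_pos c xi Hc).
Qed.

Lemma ex_RInt_kernel_re (p c a b : R) : 0 < c -> ex_RInt (kernel_re p c) a b.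
Proof.
  intros Hc; apply (ex_RInt_continuous (V := R_CompleteNormedModule)).
  intros; now apply continuous_kernel_re.
Qed.

(** Imaginary part of d/dxi (e^(i xi) s^(-p)) = i e^(i xi) (s^(-p) - p s^(-p-1)), where s = c + i
    xi. *)
Lemma is_derive_kernel_im (p c xi : R) : 0 < c ->
  is_derive (kernel_im p c) xi (kernel_re p c xi - p * kernel_re (p + 1) c xi).
Proof.
  intros Hc; assert (H := sum_sqr_pos c xi Hc).
  apply (is_derive_eq _ _ (kernel_mod p c xi * (- p * (xi / (c ^ 2 + xi ^ 2)) * sin (xi - p * atan (xi / c))
     + (1 - p * (c / (c ^ 2 + xi ^ 2))) * cos (xi - p * atan (xi / c))))).
  - rewrite <- polar_re, <- polar_im by auto; unfold kernel_re.
    replace (xi - (p + 1) * atan (xi / c)) with ((xi - p * atan (xi / c)) - atan (xi / c)) by ring.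
    rewrite (cos_minus (xi - p * atan (xi / c))), kernel_mod_plus; ring.
  - unfold kernel_im, kernel_mod; auto_derive.
    + apply H.
    + replace (c * (c * 1) + xi * (xi * 1)) with (c ^ 2 + xi ^ 2) by ring.
      unfold Rdiv, Rminus.
      set (e := exp _); set (phi := xi + - (p * _)).
      field; split; nra.
Qed.

Lemma kernel_im_0 (p c : R) : kernel_im p c 0 = 0.
Proof.
  unfold kernel_im, Rdiv.
  rewrite Rmult_0_l, atan_0, Rmult_0_r, Rminus_0_r, sin_0; apply Rmult_0_r.
Qed.

Lemma kernel_im_bound (p c xi : R) : 0 < p -> 0 < c -> 1 < xi ->
  Rabs (kernel_im p c xi) <= kernel_mod p 0 xi.
Proof.
  intros Hp Hc Hx; unfold kernel_im; rewrite Rabs_mult.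
  rewrite <- (Rmult_1_r (kernel_mod p 0 xi)).
  apply Rmult_le_compat; try apply Rabs_pos.
  - unfold kernel_mod; rewrite Rabs_pos_eq by (apply Rlt_le, exp_pos).
    apply exp_le_compat.
    assert (ln (0 ^ 2 + xi ^ 2) <= ln (c ^ 2 + xi ^ 2)) by (apply ln_le; nra).
    nra.
  - apply Rabs_le, SIN_bound.
Qed.

Lemma is_lim_kernel_im (p c : R) : 0 < p -> 0 < c -> is_lim (kernel_im p c) p_infty 0.
Proof.
  intros Hp Hc; apply (is_lim_of_bound _ (kernel_mod p 0)).
  - intros x Hx; rewrite Rminus_0_r; now apply kernel_im_bound.
  - apply (is_lim_ext_loc (fun xi => exp (- (p * ln xi)))).
    + exists 1; intros x Hx; unfold kernel_mod; f_equal.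
      replace (0 ^ 2 + x ^ 2) with (x * x) by ring; rewrite ln_mult by lra; field.
    + apply (is_lim_comp (fun u => exp (- u)) (fun xi => p * ln xi) p_infty 0 p_infty).
      * apply is_lim_exp_opp.
      * replace p_infty with (Rbar_mult p p_infty) at 2.
        -- apply (is_lim_scal_l ln), is_lim_ln_p.
        -- now apply is_Rbar_mult_unique, is_Rbar_mult_sym, is_Rbar_mult_p_infty_pos.
      * exists 0; discriminate.
Qed.

(** Half of the segment suffices: [kernel_re] is even and [kernel_im] is odd in xi, so the symmetric
    segment gives twice this integral and nothing else. *)
Definition kernel_integral (p c T : R) : R := RInt (kernel_re p c) 0 T.

(* Integration by parts, from the derivative p-recursion of s^(-p) e^s. *)
Lemma kernel_integral_step (p c L : R) : 0 < p -> 0 < c ->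
  is_lim (kernel_integral p c) p_infty L ->
  is_lim (kernel_integral (p + 1) c) p_infty (L / p).
Proof.
  intros Hp Hc HL.
  apply (is_lim_ext (fun T => (kernel_integral p c T - kernel_im p c T) * / p)).
  - intros T.
    assert (H : RInt (fun xi => kernel_re p c xi - p * kernel_re (p + 1) c xi) 0 T
                = kernel_im p c T - kernel_im p c 0).
    { apply RInt_of_derive; intros xi _; [now apply is_derive_kernel_im|].
      apply (continuous_minus (V := R_NormedModule)); [now apply continuous_kernel_re|].
      apply (continuous_scal_r (V := R_NormedModule)); now apply continuous_kernel_re. }
    rewrite (RInt_minus (V := R_CompleteNormedModule)) in H.
    2: now apply ex_RInt_kernel_re.
    2: apply (ex_RInt_scal (V := R_NormedModule)); now apply ex_RInt_kernel_re.
    rewrite (RInt_scal (V := R_CompleteNormedModule)) in H by now apply ex_RInt_kernel_re.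
    unfold minus, plus, opp, scal in H; simpl in H; unfold mult in H; simpl in H.
    rewrite kernel_im_0 in H.
    unfold kernel_integral.
    replace (kernel_im p c T) with
      (RInt (kernel_re p c) 0 T + - (p * RInt (kernel_re (p + 1) c) 0 T)) by lra.
    field; lra.
  - replace (Finite (L / p)) with (Rbar_mult (L - 0) (/ p)) by (simpl; f_equal; unfold Rdiv; ring).
    apply (is_lim_scal_r (fun T => kernel_integral p c T - kernel_im p c T)).
    apply is_lim_minus'; [exact HL|now apply is_lim_kernel_im].
Qed.

(** * The exponent 1/2 *)

(** The condition puts (x + i y)^2 in the right half plane, so doubling the argument does not leave
    the range of the arctangent. *)
Lemma atan_double (x y : R) : 0 < x -> y ^ 2 < x ^ 2 ->
  atan (2 * x * y / (x ^ 2 - y ^ 2)) = 2 * atan (y / x).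
Proof.
  intros Hx Hxy.
  assert (Hb : - 1 < y / x < 1).
  { split; apply (Rmult_lt_reg_r x); auto;
      replace (y / x * x) with y by (field; lra); nra. }
  assert (H1 := atan_increasing _ _ (proj1 Hb)).
  assert (H2 := atan_increasing _ _ (proj2 Hb)).
  replace (-1) with (Ropp 1) in H1 by ring.
  rewrite atan_opp in H1; rewrite atan_1 in H1, H2.
  rewrite <- (atan_tan (2 * atan (y / x))) by lra.
  f_equal.
  assert (Hc : cos (atan (y / x)) <> 0) by (apply Rgt_not_eq, cos_gt_0; lra).
  assert (Hc2 : cos (2 * atan (y / x)) <> 0) by (apply Rgt_not_eq, cos_gt_0; lra).
  rewrite tan_2a by (auto; rewrite tan_atan; nra).
  rewrite tan_atan; field; nra.
Qed.

(** The abscissa x of the point x + i y on the hyperbola x^2 - y^2 = c. With y as parameter the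
    branch is a graph, and the height on the original line is T = 2 x y. *)
Definition sqrt_re (c y : R) : R := sqrt (c + y ^ 2).

Section HalfPower.

Variable c : R.
Hypothesis Hc : 0 < c.

Lemma sqrt_re_pos (y : R) : 0 < sqrt_re c y.
Proof. apply sqrt_lt_R0; generalize (pow2_ge_0 y); lra. Qed.

Lemma sqrt_re_sqr (y : R) : sqrt_re c y ^ 2 = c + y ^ 2.
Proof. apply pow2_sqrt; generalize (pow2_ge_0 y); lra. Qed.

Lemma is_derive_sqrt_re (y : R) : is_derive (sqrt_re c) y (y / sqrt_re c y).
Proof.
  generalize (pow2_ge_0 y) (sqrt_re_pos y); unfold sqrt_re; intros H1 H2.
  auto_derive; [lra|].
  replace (c + y * (y * 1)) with (c + y ^ 2) by ring; field; lra.
Qed.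

(** At s = (x + i y)^2 the principal square root is x + i y itself, so the kernel is the real part
    of e^(2 i x y) / (x + i y). *)
Lemma kernel_re_half (y : R) :
  let x := sqrt_re c y in
  kernel_re (1 / 2) c (2 * x * y) =
    (x * cos (2 * x * y) + y * sin (2 * x * y)) / (x ^ 2 + y ^ 2).
Proof.
  intros x.
  assert (Hx := sqrt_re_pos y : 0 < x).
  assert (Hx2 := sqrt_re_sqr y : x ^ 2 = c + y ^ 2).
  assert (H := sum_sqr_pos x y Hx).
  unfold kernel_re.
  replace (kernel_mod (1 / 2) c (2 * x * y)) with (kernel_mod 1 x y).
  - replace (2 * x * y / c) with (2 * x * y / (x ^ 2 - y ^ 2)) by (f_equal; lra).
    rewrite atan_double by (auto; lra).
    replace (1 / 2 * (2 * atan (y / x))) with (atan (y / x)) by field.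
    rewrite cos_minus.
    transitivity (cos (2 * x * y) * (x / (x ^ 2 + y ^ 2)) + sin (2 * x * y) * (y / (x ^ 2 + y ^ 2))).
    + rewrite <- polar_re, <- polar_im by auto; ring.
    + field; lra.
  - unfold kernel_mod.
    replace (c ^ 2 + (2 * x * y) ^ 2) with ((x ^ 2 + y ^ 2) * (x ^ 2 + y ^ 2)).
    + rewrite ln_mult by auto; f_equal; field.
    + replace c with (x ^ 2 - y ^ 2) by lra; ring.
Qed.

(** Imaginary part of the integral of e^(w^2) along the horizontal segment from i y to the point x +
    i y of the hyperbola; [gauss y] is the same for the vertical segment from 0 to i y. *)
Definition gauss_rest (y : R) : R :=
  RInt (fun s => exp (s ^ 2 - y ^ 2) * sin (2 * s * y)) 0 (sqrt_re c y).

Lemma is_derive_gauss_rest (y : R) :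
  let x := sqrt_re c y in
  is_derive gauss_rest y
    (exp c * cos (2 * x * y) - exp (- y ^ 2) + exp c * sin (2 * x * y) * (y / x)).
Proof.
  intros x.
  (* By the Cauchy-Riemann equations for e^((s + i z)^2), [df] is both the z-derivative of the
     imaginary part and the s-derivative of the real part; its integral in s is therefore
     explicit. *)
  pose (df := fun z s => exp (s ^ 2 - z ^ 2) * (2 * s * cos (2 * s * z) - 2 * z * sin (2 * s * z))).
  assert (Hx2 := sqrt_re_sqr y : x ^ 2 = c + y ^ 2).
  apply (is_derive_eq _ _ (RInt (df y) 0 x + exp (x ^ 2 - y ^ 2) * sin (2 * x * y) * (y / x))).
  - rewrite (RInt_of_derive (fun s => exp (s ^ 2 - y ^ 2) * cos (2 * s * y)) (df y)).
    + replace (x ^ 2 - y ^ 2) with c by lra.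
      replace (0 ^ 2 - y ^ 2) with (- y ^ 2) by ring.
      replace (2 * 0 * y) with 0 by ring; rewrite cos_0; ring.
    + intros s _; unfold df; auto_derive; auto.
      unfold Rminus; simpl; ring.
    + intros s _; unfold df; apply continuous_of_derive; auto_derive; auto.
  - apply (is_derive_RInt_parameter_upper
      (fun z s => exp (s ^ 2 - z ^ 2) * sin (2 * s * z)) df).
    + intros z s; unfold df; auto_derive; auto; unfold Rminus; simpl; ring.
    + intros z s; unfold df; simpl; cont2d.
    + intros z s; apply continuous_of_derive; auto_derive; auto.
    + apply is_derive_sqrt_re.
Qed.

(* With s = c + i T = (x + i y)^2, the substitution s = w^2 turns
   s^(-1/2) e^s ds into 2 e^(w^2) dw; the segment from w = sqrt c is replaced
   by the path 0, i y, x + i y. *)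
Lemma kernel_integral_half (y : R) :
  kernel_integral (1 / 2) c (2 * sqrt_re c y * y) =
    2 * exp (- c) * (gauss y + gauss_rest y).
Proof.
  apply Rminus_diag_uniq.
  rewrite (const_of_derive_zero (fun y => kernel_integral (1 / 2) c (2 * sqrt_re c y * y) -
    2 * exp (- c) * (gauss y + gauss_rest y)) y 0).
  - unfold kernel_integral, gauss, gauss_rest; rewrite Rmult_0_r, !RInt_point.
    rewrite (RInt_ext _ (fun _ => 0)).
    + rewrite RInt_const; unfold scal, zero; simpl; unfold mult; simpl; ring.
    + intros s _; rewrite Rmult_0_r, sin_0; apply Rmult_0_r.
  - clear y; intros y.
    set (x := sqrt_re c y).
    assert (Hx := sqrt_re_pos y : 0 < x).
    assert (Hx2 := sqrt_re_sqr y : x ^ 2 = c + y ^ 2).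
    assert (H := sum_sqr_pos x y Hx).
    apply (is_derive_eq _ _
      (scal (2 * (y / x * y + x)) (kernel_re (1 / 2) c (2 * x * y)) -
       2 * exp (- c) * (exp (- y ^ 2) +
         (exp c * cos (2 * x * y) - exp (- y ^ 2) + exp c * sin (2 * x * y) * (y / x))))).
    + rewrite (kernel_re_half y : kernel_re (1 / 2) c (2 * x * y) = _); fold x.
      rewrite exp_Ropp; unfold scal; simpl; unfold mult; simpl.
      assert (He := exp_pos c); field; simpl in *; repeat split; lra.
    + apply (is_derive_minus (V := R_NormedModule)).
      * apply (is_derive_comp (V := R_NormedModule) (kernel_integral (1 / 2) c)
          (fun y => 2 * sqrt_re c y * y)).
        -- apply is_derive_RInt_upper; intros; now apply continuous_kernel_re.
        -- apply (is_derive_ext (fun y => 2 * (sqrt_re c y * y))); [intros; apply eq_sym, Rmult_assoc|].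
           apply is_derive_scal.
           apply (is_derive_eq _ _ (y / x * y + x * 1)); [ring|].
           apply (is_derive_mult (sqrt_re c) (fun y => y)).
           ++ apply is_derive_sqrt_re.
           ++ apply (is_derive_id (K := R_AbsRing)).
           ++ intros; apply Rmult_comm.
      * apply is_derive_scal, (is_derive_plus (V := R_NormedModule)).
        -- apply is_derive_gauss.
        -- apply is_derive_gauss_rest.
Qed.

(** On 0 <= s <= x one has s^2 <= x s, and - y^2 = c - x^2, so the integrand is dominated by e^(c -
    x^2 + x s), whose integral is less than e^c / x. *)
Lemma gauss_rest_bound (y : R) : 1 < y -> Rabs (gauss_rest y) <= exp c / y.
Proof.
  intros Hy; set (x := sqrt_re c y).
  assert (Hx := sqrt_re_pos y : 0 < x).
  assert (Hx2 := sqrt_re_sqr y : x ^ 2 = c + y ^ 2).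
  assert (Hxy : y <= x) by nra.
  assert (Hd : forall s, is_derive (fun s => exp (c - x ^ 2) * exp (x * s) / x) s (exp (c - x ^ 2 + x * s))).
  { intros s; rewrite (exp_plus (c - x ^ 2)); generalize (exp (c - x ^ 2)); intros k.
    auto_derive; auto; field; lra. }
  assert (Hcont : forall s, continuous (fun s => exp (c - x ^ 2 + x * s)) s).
  { intros s; apply continuous_of_derive; auto_derive; auto. }
  apply Rle_trans with (RInt (fun s => exp (c - x ^ 2 + x * s)) 0 x).
  - apply (norm_RInt_le (V := R_NormedModule) (fun s => exp (s ^ 2 - y ^ 2) * sin (2 * s * y))
      (fun s => exp (c - x ^ 2 + x * s)) 0 x); [lra| | |].
    + intros s Hs; change (Rabs (exp (s ^ 2 - y ^ 2) * sin (2 * s * y)) <= exp (c - x ^ 2 + x * s)).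
      rewrite Rabs_mult, <- (Rmult_1_r (exp (c - x ^ 2 + x * s))).
      apply Rmult_le_compat; try apply Rabs_pos; [|apply Rabs_le, SIN_bound].
      rewrite Rabs_pos_eq by (apply Rlt_le, exp_pos).
      apply exp_le_compat; nra.
    + apply (RInt_correct (V := R_CompleteNormedModule)), ex_RInt_of_derive.
      intros; auto_derive; auto.
    + apply (RInt_correct (V := R_CompleteNormedModule)).
      apply (ex_RInt_continuous (V := R_CompleteNormedModule)); auto.
  - rewrite (RInt_of_derive _ _ _ _ (fun s _ => Hd s) (fun s _ => Hcont s)).
    rewrite <- exp_plus; replace (c - x ^ 2 + x * x) with c by ring.
    apply Rle_trans with (exp c / x).
    + assert (0 < exp (c - x ^ 2) * exp (x * 0) / x); [|lra].
      apply Rdiv_lt_0_compat; [apply Rmult_lt_0_compat; apply exp_pos|lra].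
    + apply Rmult_le_compat_l; [apply Rlt_le, exp_pos|].
      apply Rinv_le_contravar; lra.
Qed.

(** For T >= 0, the imaginary part of the principal square root of c + i T; it inverts T = 2 x y
    along the hyperbola. *)
Definition sqrt_im (T : R) : R := sqrt ((sqrt (c ^ 2 + T ^ 2) - c) / 2).

Lemma sqrt_re_im (T : R) : 0 < T -> 2 * sqrt_re c (sqrt_im T) * sqrt_im T = T.
Proof.
  intros HT.
  assert (Hr : c <= sqrt (c ^ 2 + T ^ 2)).
  { rewrite <- (sqrt_pow2 c) at 1 by lra; apply sqrt_le_1_alt; nra. }
  unfold sqrt_re, sqrt_im; rewrite pow2_sqrt by lra.
  rewrite Rmult_assoc, <- sqrt_mult_alt by lra.
  replace ((c + (sqrt (c ^ 2 + T ^ 2) - c) / 2) * ((sqrt (c ^ 2 + T ^ 2) - c) / 2))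
    with ((sqrt (c ^ 2 + T ^ 2) ^ 2 - c ^ 2) / 4) by field.
  rewrite pow2_sqrt by nra.
  replace ((c ^ 2 + T ^ 2 - c ^ 2) / 4) with ((T / 2) ^ 2) by field.
  rewrite sqrt_pow2 by lra; field.
Qed.

Lemma is_lim_sqrt_im : is_lim sqrt_im p_infty p_infty.
Proof.
  apply is_lim_sqrt_p.
  apply (is_lim_le_p_loc (fun T => (T - c) * / 2)).
  - exists 0; intros T HT.
    assert (T <= sqrt (c ^ 2 + T ^ 2)).
    { rewrite <- (sqrt_pow2 T) at 1 by lra; apply sqrt_le_1_alt; nra. }
    lra.
  - replace p_infty with (Rbar_mult (Rbar_minus p_infty c) (/ 2)) at 2.
    + apply (is_lim_scal_r (fun T => T - c)).
      eapply is_lim_minus; [apply is_lim_id|apply is_lim_const|reflexivity].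
    + apply is_Rbar_mult_unique, is_Rbar_mult_p_infty_pos; simpl; lra.
Qed.

Lemma is_lim_kernel_integral_half :
  is_lim (kernel_integral (1 / 2) c) p_infty (sqrt PI * exp (- c)).
Proof.
  apply (is_lim_ext_loc (fun T => 2 * exp (- c) * (gauss (sqrt_im T) + gauss_rest (sqrt_im T)))).
  - exists 0; intros T HT; rewrite <- kernel_integral_half, sqrt_re_im; auto.
  - apply (is_lim_comp (fun y => 2 * exp (- c) * (gauss y + gauss_rest y)) sqrt_im _ _ p_infty).
    + replace (Finite (sqrt PI * exp (- c))) with
        (Rbar_mult (2 * exp (- c)) (sqrt PI / 2 + 0)) by (simpl; f_equal; field).
      apply (is_lim_scal_l (fun y => gauss y + gauss_rest y)).
      apply is_lim_plus'; [apply is_lim_gauss|].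
      apply (is_lim_of_bound _ (fun y => exp c / y)); [|apply is_lim_scal_inv].
      intros y Hy; rewrite Rminus_0_r; now apply gauss_rest_bound.
    + apply is_lim_sqrt_im.
    + exists 0; discriminate.
Qed.

End HalfPower.

(** * The exponent 1 *)

(* [line_re e c xi] and [line_im e c xi] are the real and imaginary parts of
   e^(e s) / s at s = c + i xi; only e = 1 and e = -1 are used. *)
Definition line_re (e c xi : R) : R :=
  exp (e * c) * (c * cos xi + e * xi * sin xi) / (c ^ 2 + xi ^ 2).

Definition line_im (e c xi : R) : R :=
  exp (e * c) * (e * c * sin xi - xi * cos xi) / (c ^ 2 + xi ^ 2).

Definition line_integral (e c T : R) : R := RInt (line_re e c) 0 T.

Section Line.

Variable e : R.
Hypothesis He : e * e = 1.

(** The common value of the c-derivative of [line_re] and the xi-derivative of [line_im], that is,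
    one of the Cauchy-Riemann equations for e^(e s) / s. *)
Definition line_cross (c xi : R) : R :=
  exp (e * c) * ((e * c + 1) * cos xi + xi * sin xi) / (c ^ 2 + xi ^ 2)
  - 2 * c * (exp (e * c) * (c * cos xi + e * xi * sin xi)) / (c ^ 2 + xi ^ 2) ^ 2.

Lemma is_derive_line_re (c xi : R) : 0 < c ->
  is_derive (fun z => line_re e z xi) c (line_cross c xi).
Proof.
  intros Hc; assert (H := sum_sqr_pos c xi Hc).
  unfold line_re, line_cross; auto_derive; [simpl in H; lra|].
  replace (xi * sin xi) with (e * e * xi * sin xi) by (rewrite He; ring).
  field; lra.
Qed.

Lemma is_derive_line_im (c xi : R) : 0 < c ->
  is_derive (line_im e c) xi (line_cross c xi).
Proof.
  intros Hc; assert (H := sum_sqr_pos c xi Hc).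
  unfold line_im, line_cross; auto_derive; [simpl in H; lra|].
  field; lra.
Qed.

Lemma continuous_line_cross (c xi : R) : 0 < c -> continuous (line_cross c) xi.
Proof.
  intros Hc; assert (H := sum_sqr_pos c xi Hc).
  unfold line_cross; apply continuous_of_derive; auto_derive.
  simpl in H; repeat split; auto; try nra.
Qed.

Lemma continuous_line_re (c xi : R) : 0 < c -> continuous (line_re e c) xi.
Proof.
  intros Hc; assert (H := sum_sqr_pos c xi Hc).
  unfold line_re; apply continuous_of_derive; auto_derive.
  simpl in H; lra.
Qed.

Lemma ex_RInt_line_re (c a b : R) : 0 < c -> ex_RInt (line_re e c) a b.
Proof.
  intros Hc; apply (ex_RInt_continuous (V := R_CompleteNormedModule)).
  intros; now apply continuous_line_re.
Qed.

(* Cauchy's theorem on a thin rectangle; nothing comes from the real axis,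
   where the integrand is real. *)
Lemma is_derive_line_integral (c T : R) : 0 < c ->
  is_derive (fun z => line_integral e z T) c (line_im e c T).
Proof.
  intros Hc.
  assert (Hloc : locally c (fun z => 0 < z)) by now apply open_gt.
  apply (is_derive_eq _ _ (RInt (line_cross c) 0 T)).
  - rewrite (RInt_of_derive (line_im e c)).
    + assert (line_im e c 0 = 0) as ->; [|ring].
      unfold line_im; rewrite sin_0, cos_0; field; lra.
    + intros xi _; now apply is_derive_line_im.
    + intros xi _; now apply continuous_line_cross.
  - apply is_derive_RInt_parameter.
    + revert Hloc; apply filter_imp; intros z Hz s; now apply is_derive_line_re.
    + intros xi; assert (H := sum_sqr_pos c xi Hc); simpl in H.
      unfold line_cross, Rdiv; simpl; cont2d; nra.
    + revert Hloc; apply filter_imp; intros z Hz; now apply ex_RInt_line_re.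
Qed.

Lemma line_im_bound (c T : R) : 0 < c -> 0 < T ->
  Rabs (line_im e c T) <= 2 * exp (e * c) / T.
Proof.
  intros Hc HT; assert (H := sum_sqr_pos c T Hc).
  assert (Hn : Rabs (e * c * sin T - T * cos T) <= c + T).
  { assert (He' : e = 1 \/ e = -1) by (destruct (Rle_dec e 0); [right|left]; nra).
    apply Rabs_le; generalize (SIN_bound T) (COS_bound T); intros [] [].
    destruct He' as [-> | ->]; nra. }
  unfold line_im, Rdiv; rewrite !Rabs_mult, (Rabs_pos_eq (exp _)) by (apply Rlt_le, exp_pos).
  rewrite (Rabs_pos_eq (/ _)) by (apply Rlt_le, Rinv_0_lt_compat; auto).
  replace (2 * exp (e * c) * / T) with (exp (e * c) * (2 * / T)) by ring.
  rewrite Rmult_assoc; apply Rmult_le_compat_l; [apply Rlt_le, exp_pos|].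
  apply (Rmult_le_reg_r (c ^ 2 + T ^ 2)); auto.
  rewrite Rmult_assoc, Rinv_l, Rmult_1_r by lra.
  apply Rle_trans with (1 := Hn).
  apply (Rmult_le_reg_l T); auto.
  replace (T * (2 * / T * (c ^ 2 + T ^ 2))) with (2 * (c ^ 2 + T ^ 2)) by (field; lra).
  nra.
Qed.

(** The difference is the contribution of a horizontal side at height T, of length at most B,
    estimated by the mean value theorem in the abscissa. M and B stay separate because for e = -1
    one can take M = 1 and let B grow with T. *)
Lemma line_integral_shift (M B T a b : R) :
  (forall c, 0 < c <= B -> exp (e * c) <= M) ->
  0 < a <= B -> 0 < b <= B -> 0 < T ->
  Rabs (line_integral e b T - line_integral e a T) <= 2 * M * B / T.
Proof.
  intros HM Ha Hb HT.
  assert (Hab : 0 < Rmin a b /\ Rmax a b <= B).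
  { split; [apply Rmin_glb_lt; lra|apply Rmax_lub; lra]. }
  destruct (MVT_gen (fun z => line_integral e z T) a b (fun z => line_im e z T)) as [z [Hz Heq]].
  - intros z Hz; apply is_derive_line_integral; lra.
  - intros z Hz; apply continuity_pt_filterlim.
    apply (continuous_of_derive (fun z => line_integral e z T)).
    exists (line_im e z T); apply is_derive_line_integral; lra.
  - rewrite Heq, Rabs_mult.
    replace (2 * M * B / T) with ((2 * M / T) * B) by (field; lra).
    apply Rmult_le_compat; try apply Rabs_pos; [|apply Rabs_le; lra].
    apply Rle_trans with (1 := line_im_bound z T ltac:(lra) HT).
    apply Rmult_le_compat_r; [apply Rlt_le, Rinv_0_lt_compat; auto|].
    apply Rmult_le_compat_l; [lra|apply HM; lra].
Qed.

End Line.

(** Far to the right e^(-b), the square of e^(-b/2), is at most 4 / b^2, and the remaining factor is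
    at most 2 / b; this still wins over the length b^2 of the segment. *)
Lemma line_integral_left_far (b : R) : 0 < b ->
  Rabs (line_integral (-1) b (b ^ 2)) <= 8 / b.
Proof.
  intros Hb.
  apply Rle_trans with ((b ^ 2 - 0) * (8 / b ^ 3)).
  2: right; field; lra.
  apply abs_RInt_le_const; [nra|apply ex_RInt_line_re; lra|].
  intros xi Hxi; assert (H := sum_sqr_pos b xi Hb).
  assert (Hn : Rabs (b * cos xi + -1 * xi * sin xi) <= b + xi).
  { apply Rabs_le; generalize (SIN_bound xi) (COS_bound xi); intros [] []; nra. }
  assert (Hexp : exp (-1 * b) <= 4 / b ^ 2).
  { replace (-1 * b) with (- (b / 2) + - (b / 2)) by field; rewrite exp_plus.
    replace (4 / b ^ 2) with (/ (b / 2) * / (b / 2)) by (field; lra).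
    apply Rmult_le_compat; try (apply Rlt_le, exp_pos); apply exp_neg_le_inv; lra. }
  unfold line_re, Rdiv; rewrite !Rabs_mult, (Rabs_pos_eq (exp _)) by (apply Rlt_le, exp_pos).
  rewrite (Rabs_pos_eq (/ _)) by (apply Rlt_le, Rinv_0_lt_compat; auto).
  replace (8 * / b ^ 3) with (4 / b ^ 2 * (2 / b)) by (field; lra).
  rewrite Rmult_assoc; apply Rmult_le_compat; auto; [apply Rlt_le, exp_pos| |].
  - apply Rmult_le_pos; [apply Rabs_pos|apply Rlt_le, Rinv_0_lt_compat; auto].
  - apply (Rmult_le_reg_r (b ^ 2 + xi ^ 2)); auto.
    rewrite Rmult_assoc, Rinv_l, Rmult_1_r by lra.
    apply Rle_trans with (1 := Hn).
    apply (Rmult_le_reg_l b); auto.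
    replace (b * (2 / b * (b ^ 2 + xi ^ 2))) with (2 * (b ^ 2 + xi ^ 2)) by (field; lra).
    nra.
Qed.

(** The abscissa sqrt T balances the two errors: 8 / sqrt T on the far line and 2 / sqrt T for
    moving there. The bound is uniform in a, which allows a = 1/T later. *)
Lemma line_integral_left_bound (a T : R) : 0 < a <= 1 -> 1 < T ->
  Rabs (line_integral (-1) a T) <= 10 / sqrt T.
Proof.
  intros Ha HT.
  assert (Hb : 1 <= sqrt T) by (rewrite <- sqrt_1; apply sqrt_le_1_alt; lra).
  assert (Hb2 : sqrt T ^ 2 = T) by (apply pow2_sqrt; lra).
  assert (H1 := line_integral_left_far (sqrt T) ltac:(lra)); rewrite Hb2 in H1.
  assert (H2 := line_integral_shift (-1) ltac:(ring) 1 (sqrt T) T a (sqrt T)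
    ltac:(intros c Hc; rewrite <- exp_0; apply exp_le_compat; lra)
    ltac:(lra) ltac:(lra) ltac:(lra)).
  replace (2 * 1 * sqrt T / T) with (2 / sqrt T) in H2
    by (rewrite <- Hb2 at 3; field; lra).
  replace (10 / sqrt T) with (8 / sqrt T + 2 / sqrt T) by (field; lra).
  apply Rabs_le_between in H1; apply Rabs_le_between in H2; apply Rabs_le; lra.
Qed.

(** The constant is 1/2 + 2, from 1 - cos x <= x^2 / 2 and 1 - cos x <= 2. *)
Lemma one_minus_cos_bound (x : R) : (1 - cos x) * (1 + x ^ 2) <= 5 / 2 * x ^ 2.
Proof.
  assert (H : 1 - cos x <= x ^ 2 / 2).
  { replace x with (2 * (x / 2)) at 1 by field; rewrite cos_2a_sin.
    assert (Hs : sin (x / 2) ^ 2 <= (x / 2) ^ 2).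
    { destruct (MVT_gen sin 0 (x / 2) cos) as [z [_ Hz]].
      - intros; apply is_derive_sin.
      - intros; apply derivable_continuous_pt, derivable_pt_sin.
      - rewrite sin_0, !Rminus_0_r in Hz; rewrite Hz, Rpow_mult_distr.
        assert (cos z ^ 2 <= 1) by (generalize (COS_bound z); nra).
        generalize (pow2_ge_0 (x / 2)); nra. }
    nra. }
  generalize (COS_bound x) (pow2_ge_0 x); intros [] ?; nra.
Qed.

Definition poisson_integral (a T : R) : R :=
  RInt (fun xi => a * cos xi / (a ^ 2 + xi ^ 2)) 0 T.

Lemma continuous_poisson (a xi : R) : 0 < a ->
  continuous (fun xi => a * cos xi / (a ^ 2 + xi ^ 2)) xi.
Proof.
  intros Ha; assert (H := sum_sqr_pos a xi Ha).
  apply continuous_of_derive; auto_derive; simpl in H; lra.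
Qed.

(* The terms odd in e cancel. *)
Lemma line_integral_add (a T : R) : 0 < a ->
  exp (- a) * line_integral 1 a T + exp a * line_integral (-1) a T = 2 * poisson_integral a T.
Proof.
  intros Ha; unfold line_integral, poisson_integral.
  generalize (RInt_scal (V := R_CompleteNormedModule) (line_re 1 a) 0 T (exp (- a))
      ltac:(apply ex_RInt_line_re; lra))
    (RInt_scal (V := R_CompleteNormedModule) (line_re (-1) a) 0 T (exp a)
      ltac:(apply ex_RInt_line_re; lra))
    (RInt_scal (V := R_CompleteNormedModule) (fun xi => a * cos xi / (a ^ 2 + xi ^ 2)) 0 T 2
      ltac:(apply (ex_RInt_continuous (V := R_CompleteNormedModule)); intros; now apply continuous_poisson)).
  unfold scal; simpl; unfold mult; simpl; intros <- <- <-.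
  rewrite <- (RInt_plus (V := R_CompleteNormedModule)).
  - apply RInt_ext; intros xi _; assert (H := sum_sqr_pos a xi Ha).
    unfold plus, line_re; simpl.
    replace (1 * a) with a by ring; replace (-1 * a) with (- a) by ring.
    rewrite exp_Ropp; assert (He := exp_pos a); simpl in H; field; lra.
  - apply (ex_RInt_scal (V := R_NormedModule) (line_re 1 a)), ex_RInt_line_re; lra.
  - apply (ex_RInt_scal (V := R_NormedModule) (line_re (-1) a)), ex_RInt_line_re; lra.
Qed.

(** Replacing cos xi by 1 gives atan (T / a) exactly. The error is dominated by (5/2) a / (1 +
    xi^2), whose integral is at most 5 a since PI <= 4, uniformly in T. *)
Lemma poisson_integral_bound (a T : R) : 0 < a -> 0 < T ->
  Rabs (poisson_integral a T - atan (T / a)) <= 5 * a.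
Proof.
  intros Ha HT.
  assert (Hd : forall xi, is_derive (fun xi => atan (xi / a)) xi (a / (a ^ 2 + xi ^ 2))).
  { intros xi; assert (H := sum_sqr_pos a xi Ha).
    auto_derive; auto; simpl in *; field; repeat split; nra. }
  assert (Hd' : forall xi, is_derive (fun xi => 5 / 2 * a * atan xi) xi (5 / 2 * a * / (1 + xi ^ 2))).
  { intros xi; apply is_derive_scal.
    rewrite <- Rsqr_pow2; apply is_derive_atan. }
  assert (Hc : forall xi, continuous (fun xi => a / (a ^ 2 + xi ^ 2)) xi).
  { intros xi; assert (H := sum_sqr_pos a xi Ha).
    apply continuous_of_derive; auto_derive; simpl in H; lra. }
  assert (Hc' : forall xi, continuous (fun xi => 5 / 2 * a * / (1 + xi ^ 2)) xi).
  { intros xi; assert (H := one_plus_sqr_pos xi).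
    apply continuous_of_derive; auto_derive; simpl in H; lra. }
  assert (Hex : forall f : R -> R, (forall xi, continuous f xi) -> is_RInt f 0 T (RInt f 0 T)).
  { intros f Hf; apply (RInt_correct (V := R_CompleteNormedModule)),
      (ex_RInt_continuous (V := R_CompleteNormedModule)); auto. }
  assert (I1 := RInt_of_derive _ _ 0 T (fun xi _ => Hd xi) (fun xi _ => Hc xi)).
  assert (I2 := RInt_of_derive _ _ 0 T (fun xi _ => Hd' xi) (fun xi _ => Hc' xi)).
  cbv beta in I1, I2.
  replace (0 / a) with 0 in I1 by (field; lra).
  rewrite atan_0, Rminus_0_r in I1; rewrite atan_0, Rmult_0_r, Rminus_0_r in I2.
  rewrite <- I1; apply Rle_trans with (5 / 2 * a * atan T).
  2: generalize (atan_bound T) PI_4; intros; nra.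
  rewrite <- I2.
  apply (norm_RInt_le (V := R_NormedModule)
    (fun xi => minus (a * cos xi / (a ^ 2 + xi ^ 2)) (a / (a ^ 2 + xi ^ 2)))
    (fun xi => 5 / 2 * a * / (1 + xi ^ 2)) 0 T); [lra| | |now apply Hex].
  - intros xi _; assert (H := sum_sqr_pos a xi Ha); assert (H' := one_plus_sqr_pos xi).
    change (Rabs (a * cos xi / (a ^ 2 + xi ^ 2) - a / (a ^ 2 + xi ^ 2)) <= 5 / 2 * a * / (1 + xi ^ 2)).
    replace (a * cos xi / (a ^ 2 + xi ^ 2) - a / (a ^ 2 + xi ^ 2)) with
      (- (a * ((1 - cos xi) / (a ^ 2 + xi ^ 2)))) by (field; lra).
    assert (Hcos := COS_bound xi).
    rewrite Rabs_Ropp, Rabs_pos_eq.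
    2: apply Rmult_le_pos; [lra|apply Rmult_le_pos; [lra|apply Rlt_le, Rinv_0_lt_compat; auto]].
    replace (5 / 2 * a * / (1 + xi ^ 2)) with (a * (5 / 2 / (1 + xi ^ 2))) by (field; lra).
    apply Rmult_le_compat_l; [lra|].
    apply (Rmult_le_reg_r ((a ^ 2 + xi ^ 2) * (1 + xi ^ 2))); [now apply Rmult_lt_0_compat|].
    replace ((1 - cos xi) / (a ^ 2 + xi ^ 2) * ((a ^ 2 + xi ^ 2) * (1 + xi ^ 2)))
      with ((1 - cos xi) * (1 + xi ^ 2)) by (field; lra).
    replace (5 / 2 / (1 + xi ^ 2) * ((a ^ 2 + xi ^ 2) * (1 + xi ^ 2)))
      with (5 / 2 * (a ^ 2 + xi ^ 2)) by (field; lra).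
    generalize (one_minus_cos_bound xi) (pow2_ge_0 a); lra.
  - apply (is_RInt_minus (V := R_NormedModule)); apply Hex; auto.
    intros; now apply continuous_poisson.
Qed.

(** With a = 1/T the error above is 5 / T and the main term is atan (T^2), so a -> 0 and T ->
    infinity merge into one limit. *)
Lemma is_lim_poisson_integral :
  is_lim (fun T => poisson_integral (/ T) T) p_infty (PI / 2).
Proof.
  assert (Hinv : is_lim (fun T => / T) p_infty 0).
  { apply (is_lim_inv (fun T => T) p_infty p_infty); [apply is_lim_id|discriminate]. }
  apply (is_lim_ext_loc (fun T => (poisson_integral (/ T) T - atan (T / / T)) + (PI / 2 - atan (/ T * / T)))).
  { exists 0; intros T HT.
    replace (T / / T) with (/ (/ T * / T)) by (field; lra).
    rewrite atan_inv; [ring|].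
    apply Rmult_lt_0_compat; now apply Rinv_0_lt_compat. }
  replace (Finite (PI / 2)) with (Finite (0 + (PI / 2 - atan 0))) by (rewrite atan_0; f_equal; ring).
  apply is_lim_plus'.
  - apply (is_lim_of_bound _ (fun T => 5 / T)); [|apply is_lim_scal_inv].
    intros T HT; rewrite Rminus_0_r; unfold Rdiv at 2.
    apply poisson_integral_bound; [apply Rinv_0_lt_compat|]; lra.
  - apply is_lim_minus'; [apply is_lim_const|].
    apply (is_lim_comp_continuous (fun T => / T * / T) atan).
    + replace (Finite 0) with (Rbar_mult 0 0) by (simpl; f_equal; ring).
      apply is_lim_mult; auto; simpl; auto.
    + apply continuous_of_derive; eexists; apply is_derive_atan.
Qed.

Lemma is_lim_kernel_integral_1 (c : R) : 0 < c ->
  is_lim (kernel_integral 1 c) p_infty (PI * exp (- c)).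
Proof.
  intros Hc.
  apply (is_lim_ext (fun T => line_integral 1 c T * exp (- c))).
  { intros T; unfold line_integral, kernel_integral; rewrite Rmult_comm.
    rewrite <- (RInt_scal (V := R_CompleteNormedModule) (line_re 1 c)) by (apply ex_RInt_line_re; lra).
    apply RInt_ext; intros xi _; rewrite kernel_re_1 by auto; unfold line_re.
    unfold scal; simpl; unfold mult; simpl.
    rewrite exp_Ropp, !Rmult_1_l; assert (He := exp_pos c).
    assert (H := sum_sqr_pos c xi Hc); simpl in H; field; lra. }
  apply (is_lim_scal_r (line_integral 1 c) (exp (- c)) p_infty PI).
  assert (Hinv : is_lim (fun T => / T) p_infty 0).
  { apply (is_lim_inv (fun T => T) p_infty p_infty); [apply is_lim_id|discriminate]. }
  assert (Hexp : is_lim (fun T => exp (/ T)) p_infty 1).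
  { rewrite <- exp_0; apply (is_lim_comp_continuous (fun T => / T) exp); auto.
    apply continuous_of_derive; auto_derive; auto. }
  (* The line is moved from c to 1/T; the second summand is [line_integral_add] at a = 1/T, solved
     for the integral of e^s / s. *)
  apply (is_lim_ext_loc (fun T => (line_integral 1 c T - line_integral 1 (/ T) T) +
    exp (/ T) * (2 * poisson_integral (/ T) T - exp (/ T) * line_integral (-1) (/ T) T))).
  { exists 0; intros T HT; rewrite <- line_integral_add by now apply Rinv_0_lt_compat.
    rewrite exp_Ropp; assert (He := exp_pos (/ T)); field; lra. }
  replace (Finite PI) with (Finite (0 + 1 * (2 * (PI / 2) - 1 * 0))) by (f_equal; field).
  apply is_lim_plus'.
  (* The bound B = c + 1 covers both abscissas c and 1/T < 1. *)
  - apply (is_lim_of_bound _ (fun T => 2 * exp (c + 1) * (c + 1) / T)); [|apply is_lim_scal_inv].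
    intros T HT; rewrite Rminus_0_r.
    assert (0 < / T < 1).
    { split; [apply Rinv_0_lt_compat; lra|].
      rewrite <- Rinv_1; apply Rinv_lt_contravar; lra. }
    apply line_integral_shift; try lra.
    intros z Hz; apply exp_le_compat; lra.
  - apply (is_lim_mult (fun T => exp (/ T)) _ p_infty 1 (2 * (PI / 2) - 1 * 0)); simpl; auto.
    apply is_lim_minus'.
    + apply (is_lim_scal_l _ 2 p_infty (PI / 2)), is_lim_poisson_integral.
    + apply (is_lim_mult (fun T => exp (/ T)) _ p_infty 1 0); simpl; auto.
      apply (is_lim_of_bound _ (fun T => 10 / sqrt T)).
      * intros T HT; rewrite Rminus_0_r; apply line_integral_left_bound; auto.
        split; [apply Rinv_0_lt_compat; lra|].
        rewrite <- Rinv_1; apply Rinv_le_contravar; lra.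
      * apply (is_lim_comp (fun u => 10 / u) sqrt p_infty 0 p_infty).
        -- apply is_lim_scal_inv.
        -- apply (is_lim_sqrt_p (fun x => x)), is_lim_id.
        -- exists 0; discriminate.
Qed.

(** * Assembling and scaling *)

(** The step p -> p + 1 multiplies the Gamma factor by p and divides the limit by p, so the product
    is invariant and neither factor has to be evaluated for general p. *)
Lemma Gamma_mul_kernel_limit (n : nat) (c : R) : (1 <= n)%nat -> 0 < c ->
  exists g L : R,
    is_Gamma ((INR n + 1) / 2) g /\
    is_lim (kernel_integral ((INR n + 1) / 2) c) p_infty L /\
    g * L = PI * exp (- c).
Proof.
  intros Hn Hc.
  pose (P p := exists g L : R, is_Gamma p g /\
    is_lim (kernel_integral p c) p_infty L /\ g * L = PI * exp (- c)).
  assert (Hstep : forall p, 0 < p -> P p -> P (p + 1)).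
  { intros p Hp [g [L [Hg [HL HgL]]]]; exists (p * g), (L / p); repeat split.
    - now apply is_Gamma_step.
    - now apply kernel_integral_step.
    - rewrite <- HgL; field; lra. }
  assert (H1 : P 1).
  { exists 1, (PI * exp (- c)); repeat split; [apply is_Gamma_1|now apply is_lim_kernel_integral_1|ring]. }
  (* The exponent 1/2 is used for the kernel alone; one step brings it to 3/2, where it meets
     Gamma(3/2). *)
  assert (H3 : P (3 / 2)).
  { exists (sqrt PI / 2), (sqrt PI * exp (- c) / (1 / 2)); repeat split.
    - apply is_Gamma_3_2.
    - replace (3 / 2) with (1 / 2 + 1) by field.
      apply kernel_integral_step; [lra|auto|now apply is_lim_kernel_integral_half].
    - rewrite <- (sqrt_sqrt PI) at 3 by (generalize PI_RGT_0; lra); field. }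
  (* Raising p by 1 raises n by 2, so the induction carries two consecutive dimensions. *)
  assert (Hall : forall k, P ((INR (S k) + 1) / 2) /\ P ((INR (S (S k)) + 1) / 2)).
  { induction k as [|k [IH1 IH2]].
    - split; simpl INR; [replace ((1 + 1) / 2) with 1 by field|
        replace ((1 + 1 + 1) / 2) with (3 / 2) by field]; auto.
    - split; auto.
      replace ((INR (S (S (S k))) + 1) / 2) with ((INR (S k) + 1) / 2 + 1)
        by (rewrite !S_INR; field).
      apply Hstep; auto; generalize (pos_INR (S k)); lra. }
  destruct n as [|k]; [lia|exact (proj1 (Hall k))].
Qed.

(** * From the complex integrand to the real kernels *)

Lemma Cexp_div_Cpower (a b c y p : R) : 0 < c ->
  (Cexp (a, b) / Cpower (c, y) p)%C =
    (exp a * (kernel_mod p c y * cos (b - p * atan (y / c))),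
     exp a * (kernel_mod p c y * sin (b - p * atan (y / c)))).
Proof.
  intros Hc; assert (H := sum_sqr_pos c y Hc).
  assert (Hpow : Cpower (c, y) p =
    (/ kernel_mod p c y * cos (p * atan (y / c)), / kernel_mod p c y * sin (p * atan (y / c)))).
  { unfold Cpower, Cexp, Clog, Carg, Cmult, RtoC; cbn [Re Im fst snd].
    change (Cmod (c, y)) with (sqrt (c ^ 2 + y ^ 2)).
    destruct (Rlt_dec 0 c) as [_|]; [|lra].
    rewrite Rmult_0_l, Rminus_0_r, Rmult_0_l, Rplus_0_r.
    replace (exp (p * ln (sqrt (c ^ 2 + y ^ 2)))) with (/ kernel_mod p c y); auto.
    unfold kernel_mod; rewrite <- exp_Ropp; f_equal.
    rewrite <- Rpower_sqrt by auto; unfold Rpower; rewrite ln_exp; field. }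
  rewrite Hpow.
  assert (Hk : 0 < kernel_mod p c y) by apply exp_pos.
  assert (Hsc := sin2_cos2 (p * atan (y / c))); unfold Rsqr in Hsc.
  rewrite cos_minus, sin_minus.
  set (k := kernel_mod p c y) in *; set (co := cos (p * _)) in *; set (si := sin (p * _)) in *.
  unfold Cexp, Cdiv, Cmult, Cinv; simpl.
  replace (/ k * co * (/ k * co * 1) + / k * si * (/ k * si * 1))
    with (/ k * / k * (si * si + co * co)) by ring.
  rewrite Hsc; apply injective_projections; simpl; field; lra.
Qed.

Lemma kernel_mod_scale (lam p c xi : R) : 0 < lam -> 0 < c ->
  kernel_mod p c xi = Rpower lam p * kernel_mod p (lam * c) (lam * xi).
Proof.
  intros Hl Hc; assert (H := sum_sqr_pos c xi Hc).
  unfold kernel_mod, Rpower; rewrite <- exp_plus; f_equal.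
  replace ((lam * c) ^ 2 + (lam * xi) ^ 2) with (lam * lam * (c ^ 2 + xi ^ 2)) by ring.
  rewrite !ln_mult by nra; field.
Qed.

Lemma kernel_re_even (p c xi : R) : kernel_re p c (- xi) = kernel_re p c xi.
Proof.
  unfold kernel_re, kernel_mod.
  replace ((- xi) ^ 2) with (xi ^ 2) by ring.
  replace (- xi / c) with (- (xi / c)) by (unfold Rdiv; ring).
  rewrite atan_opp, <- (cos_neg (xi - p * atan (xi / c))); f_equal; f_equal; ring.
Qed.

Lemma kernel_im_odd (p c xi : R) : kernel_im p c (- xi) = - kernel_im p c xi.
Proof.
  unfold kernel_im, kernel_mod.
  replace ((- xi) ^ 2) with (xi ^ 2) by ring.
  replace (- xi / c) with (- (xi / c)) by (unfold Rdiv; ring).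
  rewrite atan_opp, Ropp_mult_distr_r, <- sin_neg; f_equal; f_equal; ring.
Qed.

Lemma is_RInt_scaled (f : R -> R) (lam K a b : R) : 0 < lam ->
  (forall x, continuous f x) ->
  is_RInt (fun xi => K * f (lam * xi)) a b
    (K / lam * (RInt f 0 (lam * b) - RInt f 0 (lam * a))).
Proof.
  intros Hl Hf.
  replace (K / lam * (RInt f 0 (lam * b) - RInt f 0 (lam * a))) with
    (minus (K / lam * RInt f 0 (lam * b)) (K / lam * RInt f 0 (lam * a)))
    by (unfold minus, plus, opp; simpl; ring).
  apply (is_RInt_derive (V := R_CompleteNormedModule) (fun x => K / lam * RInt f 0 (lam * x))).
  - intros x _; apply (is_derive_eq _ _ (K / lam * (lam * f (lam * x)))); [field; lra|].
    apply is_derive_scal.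
    apply (is_derive_comp (V := R_NormedModule) (fun z => RInt f 0 z) (fun x => lam * x)).
    + now apply is_derive_RInt_upper.
    + apply (is_derive_eq _ _ (lam * 1)); [ring|].
      apply is_derive_scal, (is_derive_id (K := R_AbsRing)).
  - intros x _; apply (continuous_scal_r (V := R_NormedModule)).
    apply (continuous_comp (fun x => lam * x) f); auto.
    apply continuous_of_derive; auto_derive; auto.
Qed.

Lemma RInt_reflect (f : R -> R) (T : R) :
  (forall x, continuous f x) ->
  RInt f 0 (- T) = - RInt (fun x => f (- x)) 0 T.
Proof.
  intros Hf.
  rewrite (RInt_of_derive (fun x => - RInt f 0 (- x)) (fun x => f (- x)) 0 T).
  - rewrite Ropp_0, RInt_point; unfold zero; simpl.
    now rewrite Ropp_0, Rminus_0_r, Ropp_involutive.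
  - intros x _; apply (is_derive_eq _ _ (opp (-1 * f (- x)))); [unfold opp; simpl; ring|].
    apply (is_derive_opp (V := R_NormedModule)).
    apply (is_derive_comp (V := R_NormedModule) (fun z => RInt f 0 z) (fun x => - x)).
    + now apply is_derive_RInt_upper.
    + auto_derive; auto.
  - intros x _; apply (continuous_comp Ropp f); auto.
    apply continuous_of_derive; auto_derive; auto.
Qed.

Lemma continuous_kernel_im (p c xi : R) : 0 < c -> continuous (kernel_im p c) xi.
Proof.
  intros Hc; apply continuous_of_derive; eexists; now apply is_derive_kernel_im.
Qed.

Lemma kernel_integral_odd (p c T : R) : 0 < c ->
  kernel_integral p c (- T) = - kernel_integral p c T.
Proof.
  intros Hc; unfold kernel_integral.
  rewrite RInt_reflect by (intros; now apply continuous_kernel_re).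
  f_equal; apply RInt_ext; intros; apply kernel_re_even.
Qed.

Lemma RInt_kernel_im_even (p c T : R) : 0 < c ->
  RInt (kernel_im p c) 0 (- T) = RInt (kernel_im p c) 0 T.
Proof.
  intros Hc; rewrite RInt_reflect by (intros; now apply continuous_kernel_im).
  rewrite (RInt_ext _ (fun x => opp (kernel_im p c x))) by (intros; apply kernel_im_odd).
  rewrite (RInt_opp (V := R_CompleteNormedModule)).
  - apply Ropp_involutive.
  - apply (ex_RInt_continuous (V := R_CompleteNormedModule)).
    intros; now apply continuous_kernel_im.
Qed.

(** Scaling by lam > 0 keeps the argument of s and multiplies its modulus, whence the factor lam^p.
    The exponential carries sigma only, not d + sigma: this mismatch is what leaves e^(-lam d), the
    Gaussian of the heat kernel. *)
Lemma integrand_scaled (lam p d sigma xi : R) : 0 < lam -> 0 < d + sigma ->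
  (Cexp (lam * sigma, lam * xi)%R / Cpower (d + sigma, xi)%R p)%C =
    (exp (lam * sigma) * Rpower lam p * kernel_re p (lam * (d + sigma)) (lam * xi),
     exp (lam * sigma) * Rpower lam p * kernel_im p (lam * (d + sigma)) (lam * xi)).
Proof.
  intros Hl Hd; rewrite Cexp_div_Cpower by auto.
  rewrite (kernel_mod_scale lam) by auto; unfold kernel_re, kernel_im.
  replace (lam * xi / (lam * (d + sigma))) with (xi / (d + sigma)) by (field; lra).
  apply injective_projections; simpl; ring.
Qed.

Lemma is_lim_scaled (f : R -> R) (lam L : R) : 0 < lam ->
  is_lim f p_infty L -> is_lim (fun T => f (lam * T)) p_infty L.
Proof.
  intros Hl H; apply (is_lim_comp f (fun T => lam * T) p_infty L p_infty); auto.
  - replace p_infty with (Rbar_mult lam p_infty) at 2.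
    + apply (is_lim_scal_l (fun T => T)), is_lim_id.
    + now apply is_Rbar_mult_unique, is_Rbar_mult_sym, is_Rbar_mult_p_infty_pos.
  - exists 0; discriminate.
Qed.

(** On every symmetric segment the real component is exactly 0, because [kernel_im] is odd; only the
    even [kernel_re] contributes, twice, and it is multiplied by i from ds. *)
Lemma vertical_line_RInt (lam p d sigma L : R) : 0 < lam -> 0 < d + sigma ->
  is_lim (kernel_integral p (lam * (d + sigma))) p_infty L ->
  is_vertical_line_RInt
    (fun s => Cexp (s / RtoC (/ lam)) / Cpower (RtoC d + s) p)%C sigma
    (0, 2 * (exp (lam * sigma) * Rpower lam p / lam) * L).
Proof.
  intros Hl Hd HL; assert (Hc : 0 < lam * (d + sigma)) by now apply Rmult_lt_0_compat.
  set (k := exp (lam * sigma) * Rpower lam p).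
  set (c := lam * (d + sigma)) in *.
  apply (filterlimi_lim_ext_loc
    (fun T => (0, 2 * (k / lam) * kernel_integral p c (lam * T)) : C)).
  - apply filter_forall; intros T; unfold is_vertical_segment_RInt.
    apply (is_RInt_ext (V := C_R_NormedModule)
      (fun xi => (- k * kernel_im p c (lam * xi), k * kernel_re p c (lam * xi)))).
    + intros xi _.
      replace ((RtoC sigma + Ci * RtoC xi) / RtoC (/ lam))%C with ((lam * sigma, lam * xi)%R : C).
      2: apply injective_projections; unfold Cdiv, Cmult, Cinv, Cplus, Ci, RtoC; simpl; field; lra.
      replace (RtoC d + (RtoC sigma + Ci * RtoC xi))%C with ((d + sigma, xi)%R : C).
      2: apply injective_projections; unfold Cmult, Cplus, Ci, RtoC; simpl; ring.
      rewrite integrand_scaled by auto; fold k; fold c.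
      apply injective_projections; unfold Cmult, Ci; simpl; ring.
    + apply (is_RInt_fct_extend_pair (U := R_NormedModule) (V := R_NormedModule)).
      * simpl; replace 0 with (- k / lam * (RInt (kernel_im p c) 0 (lam * T) - RInt (kernel_im p c) 0 (lam * - T))).
        -- apply is_RInt_scaled; auto; intros; now apply continuous_kernel_im.
        -- rewrite <- Ropp_mult_distr_r, RInt_kernel_im_even by auto; ring.
      * simpl; replace (2 * (k / lam) * kernel_integral p c (lam * T)) with
          (k / lam * (kernel_integral p c (lam * T) - kernel_integral p c (lam * - T))).
        -- apply is_RInt_scaled; auto; intros; now apply continuous_kernel_re.
        -- rewrite <- Ropp_mult_distr_r, kernel_integral_odd by auto; ring.
  - apply filterlim_locally; intros eps.
    assert (Hlim : is_lim (fun T => 2 * (k / lam) * kernel_integral p c (lam * T)) p_infty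
              (2 * (k / lam) * L)).
    { apply (is_lim_scal_l (fun T => kernel_integral p c (lam * T)) (2 * (k / lam)) p_infty L).
      now apply is_lim_scaled. }
    generalize (proj1 (filterlim_locally (F := Rbar_locally p_infty) _ _) Hlim eps).
    apply filter_imp; intros T HT; split; [apply ball_center|exact HT].
Qed.

(** Here the line is followed downwards, at a - i xi; evenness of [kernel_re] makes the direction
    immaterial. *)
Lemma half_line_RInt (lam p d a L : R) : 0 < lam -> 0 < d + a ->
  is_lim (kernel_integral p (lam * (d + a))) p_infty L ->
  is_RInt_gen
    (fun xi => Re (Cexp ((RtoC a - Ci * RtoC xi) / RtoC (/ lam)) /
                   Cpower (RtoC d + (RtoC a - Ci * RtoC xi)) p)%C)
    (at_point 0) (Rbar_locally p_infty) (exp (lam * a) * Rpower lam p / lam * L).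
Proof.
  intros Hl Hd HL; assert (Hc : 0 < lam * (d + a)) by now apply Rmult_lt_0_compat.
  set (k := exp (lam * a) * Rpower lam p).
  set (c := lam * (d + a)) in *.
  apply (filterlimi_lim_ext_loc (fun ab : R * R => k / lam * kernel_integral p c (lam * snd ab))).
  - apply (Filter_prod _ _ _ (fun u => u = 0) (fun _ => True)); [reflexivity|exists 0; auto|].
    intros u T -> _; simpl fst; simpl snd.
    apply (is_RInt_ext (fun xi => k * kernel_re p c (lam * xi))).
    + intros xi _.
      replace ((RtoC a - Ci * RtoC xi) / RtoC (/ lam))%C with ((lam * a, lam * - xi)%R : C).
      2: apply injective_projections; unfold Cdiv, Cmult, Cinv, Cminus, Cplus, Copp, Ci, RtoC; simpl; field; lra.
      replace (RtoC d + (RtoC a - Ci * RtoC xi))%C with ((d + a, - xi)%R : C).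
      2: apply injective_projections; unfold Cmult, Cminus, Cplus, Copp, Ci, RtoC; simpl; ring.
      rewrite integrand_scaled by auto; fold k; fold c; simpl.
      now rewrite <- Ropp_mult_distr_r, kernel_re_even.
    + replace (k / lam * kernel_integral p c (lam * T)) with
        (k / lam * (kernel_integral p c (lam * T) - kernel_integral p c (lam * 0))).
      * apply is_RInt_scaled; auto; intros; now apply continuous_kernel_re.
      * unfold kernel_integral at 2; rewrite Rmult_0_r, RInt_point; unfold zero; simpl; ring.
  - apply (filterlim_comp _ _ _ snd (fun T => k / lam * kernel_integral p c (lam * T)) _ (Rbar_locally p_infty)).
    + apply filterlim_snd.
    + apply (is_lim_scal_l (fun T => kernel_integral p c (lam * T)) (k / lam) p_infty L).
      now apply is_lim_scaled.
Qed.

(** A count of exponents: 4 t occurs to the power -(n+1)/2 + 1 - 1/2 = -n/2, PI to the power 1 -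
    (n/2 + 1) = -n/2, and sigma drops out of the exponential. *)
Lemma heat_kernel_constant (n : nat) (t sigma L : R) (x x' : Vector.t R n) :
  0 < t ->
  Gamma ((INR n + 1) / 2) * L = PI * exp (- (/ (4 * t) * (dist_eucl x x' ^ 2 + sigma))) ->
  heat_kernel n t x x' =
    Gamma ((INR n + 1) / 2) / (Rpower PI (INR n / 2 + 1) * Rpower (4 * t) (1 / 2)) *
    (exp (/ (4 * t) * sigma) * Rpower (/ (4 * t)) ((INR n + 1) / 2) / / (4 * t) * L).
Proof.
  intros Ht HL; assert (HP := PI_RGT_0).
  set (D := dist_eucl x x' ^ 2) in *; set (q := INR n) in *.
  assert (Hprod : forall u v w z : R, Gamma ((q + 1) / 2) / (u * v) * (w * z / / (4 * t) * L) =
    Gamma ((q + 1) / 2) * L * (w * z * (4 * t)) * / u * / v).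
  { intros; unfold Rdiv; rewrite Rinv_inv, Rinv_mult; ring. }
  rewrite Hprod, HL; unfold heat_kernel; fold D q.
  rewrite <- !Rpower_Ropp.
  rewrite <- (exp_ln PI) at 2 by lra.
  rewrite <- (exp_ln (4 * t)) at 5 by lra.
  unfold Rpower; rewrite <- !exp_plus; f_equal.
  rewrite ln_Rinv by lra.
  replace (4 * PI * t) with (4 * t * PI) by ring.
  rewrite (ln_mult (4 * t) PI) by lra.
  field; lra.
Qed.

Theorem theorem2p1 :
  forall (n : nat) (t : R) (x x' : Vector.t R n),
    (1 <= n)%nat -> (0 < t)%R ->
    (forall sigma : R, (0 < sigma)%R ->
      exists I : C,
        is_vertical_line_RInt
          (fun s : C =>
             (Cexp (s / RtoC (4 * t)) /
              Cpower (RtoC (dist_eucl x x' ^ 2) + s) ((INR n + 1) / 2))%C)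
          sigma I /\
        RtoC (heat_kernel n t x x') =
          (RtoC (Gamma ((INR n + 1) / 2)) /
           (RtoC 2 * Ci * RtoC (Rpower PI (INR n / 2 + 1)) *
            RtoC (Rpower (4 * t) (1 / 2))) * I)%C) /\
    (forall a : R, (0 < a)%R ->
      exists J : R,
        is_RInt_gen
          (fun xi : R =>
             Re (Cexp ((RtoC a - Ci * RtoC xi) / RtoC (4 * t)) /
                 Cpower (RtoC (dist_eucl x x' ^ 2) + (RtoC a - Ci * RtoC xi))
                   ((INR n + 1) / 2))%C)
          (at_point 0%R) (Rbar_locally p_infty) J /\
        heat_kernel n t x x' =
          (Gamma ((INR n + 1) / 2) /
           (Rpower PI (INR n / 2 + 1) * Rpower (4 * t) (1 / 2)) * J)%R).
Proof.
  intros n t x x' Hn Ht.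
  assert (Hl : 0 < / (4 * t)) by (apply Rinv_0_lt_compat; lra).
  assert (Hlim : forall sigma, 0 < sigma -> 0 < dist_eucl x x' ^ 2 + sigma /\ exists L : R,
    is_lim (kernel_integral ((INR n + 1) / 2) (/ (4 * t) * (dist_eucl x x' ^ 2 + sigma))) p_infty L /\
    heat_kernel n t x x' =
      Gamma ((INR n + 1) / 2) / (Rpower PI (INR n / 2 + 1) * Rpower (4 * t) (1 / 2)) *
      (exp (/ (4 * t) * sigma) * Rpower (/ (4 * t)) ((INR n + 1) / 2) / / (4 * t) * L)).
  { intros sigma Hs.
    assert (Hd : 0 < dist_eucl x x' ^ 2 + sigma) by (generalize (pow2_ge_0 (dist_eucl x x')); lra).
    split; auto.
    destruct (Gamma_mul_kernel_limit n (/ (4 * t) * (dist_eucl x x' ^ 2 + sigma)) Hn)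
      as [g [L [Hg [HL HgL]]]]; [now apply Rmult_lt_0_compat|].
    exists L; split; auto; apply heat_kernel_constant; auto.
    rewrite (Gamma_unique _ _ Hg); exact HgL. }
  (* Writing 4 t as the inverse of lam = / (4 t) brings both integrands into the scaled form. *)
  rewrite <- (Rinv_inv (4 * t)).
  split; intros s Hs; destruct (Hlim s Hs) as [Hd [L [HL Heat]]].
  - eexists; split; [exact (vertical_line_RInt _ _ _ _ _ Hl Hd HL)|].
    rewrite Heat, Rinv_inv.
    assert (HP : 0 < Rpower PI (INR n / 2 + 1)) by apply exp_pos.
    assert (HT : 0 < Rpower (4 * t) (1 / 2)) by apply exp_pos.
    apply injective_projections; unfold Cdiv, Cmult, Cinv, Ci, RtoC; simpl; field; lra.
  - eexists; split; [exact (half_line_RInt _ _ _ _ _ Hl Hd HL)|].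
    rewrite Heat, Rinv_inv; reflexivity.
Qed.
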